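(* Let $\nu\in\mathbb C$ and let $(V,e)$ be a finite-dimensional unital vector space. The complex tensor power $V^{\underline\otimes\nu}$, as an object of $Ind\text{-}(\underline{Rep}(S_\nu)\boxtimes O^{\mathfrak p}_{\nu,V})$, depends only on the distinguished non-zero vector $e$ and not on the splitting of $V$. That is, for any two splittings $V=\mathbb Ce\oplus U$ and $V=\mathbb Ce\oplus W$, the canonical morphism $$(\mathrm{Id}_V)^{\underline\otimes\nu}:\bigoplus_{k\ge0}(U^{\otimes k}\otimes\Delta_k)^{S_k}\longrightarrow\bigoplus_{k\ge0}(W^{\otimes k}\otimes\Delta_k)^{S_k}$$ is an isomorphism in $Ind\text{-}\underline{Rep}(S_\nu)$ which intertwines the two actions of $\mathfrak{gl}(V)$ defined using the splittings $\mathbb Ce\oplus U$ and $\mathbb Ce\oplus W$ respectively.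
   Context: Base field $\mathbb{C}$; $\mathbb{Z}_+=\{0,1,2,\dots\}$. **Deligne category.** For $\nu\in\mathbb C$, $\underline{Rep}(S_\nu)$ is Deligne's $\mathbb C$-linear Karoubian rigid symmetric monoidal category. It is the (additive) Karoubi envelope of the category with objects $\Delta_k$ ($k\ge 0$) and $\mathrm{Hom}(\Delta_r,\Delta_s)=\mathbb C\bar P_{r,s}$, where $\bar P_{r,s}$ is the set of partitions of $\{1,\dots,r,1',\dots,s'\}$ into disjoint parts such that no part contains two distinct unprimed elements or two distinct primed elements. Composition: for $\pi\in\bar P_{r,s}$, $\rho\in\bar P_{s,t}$, glue the diagrams along the middle row; let $\rho\star\pi\in\bar P_{r,t}$ be the induced partition on the outer rows and $n(\rho,\pi)$ the number of connected components lying entirely in the middle row; then $\rho\circ\pi=\sum_{\tau}\prod_{j=0}^{n(\rho,\pi)-1}(\nu-l(\tau)-j)\,\tau$, the sum over $\tau\in\bar P_{r,t}$ coarser than or equal to $\rho\star\pi$, with $l(\tau)$ the number of parts. The symmetric group $S_k$ acts on $\Delta_k$ by partitions all of whose parts are of the form $\{i,\sigma(i)'\}$. **Morphisms between the $\Delta_k$.** $res_l:\Delta_{k+1}\to\Delta_k$ is the partition with parts $\{i,i'\}$ for $i<l$, $\{i+1,i'\}$ for $l\le i\le k$, and the singleton $\{l\}$. $res_l^*:\Delta_k\to\Delta_{k+1}$ is the partition with parts $\{i,i'\}$ for $i<l$, $\{i,(i+1)'\}$ for $l\le i\le k$, and the singleton $\{l'\}$. For a strictly increasing $\iota:\{1,\dots,l\}\to\{1,\dots,k\}$,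 $res_\iota:\Delta_k\to\Delta_l$ is the partition with parts $\{\iota(i),i'\}$, $1\le i\le l$, and all other elements singletons. **Unital spaces.** A unital vector space is a pair $(V,e)$ with $e\in V$, $e\neq0$. Given a splitting $V=\mathbb Ce\oplus U$ we have $\mathfrak{gl}(V)=\mathbb C\,\mathrm{Id}_V\oplus\mathfrak u^-\oplus\mathfrak u^+\oplus\mathfrak{gl}(U)$, where $\mathfrak u^-\cong U$ ($u$ corresponds to $e\mapsto u$, $U\mapsto0$) and $\mathfrak u^+\cong U^*$ ($f$ corresponds to $e\mapsto0$, $v\mapsto f(v)e$ for $v\in U$). $\mathfrak p=\{\phi\in\mathfrak{gl}(V):\phi(e)\in\mathbb Ce\}$. $O^{\mathfrak p}_{\nu,V}$ is the category of finitely generated $\mathcal U(\mathfrak{gl}(V))$-modules whose restriction to $\mathfrak{gl}(U)$ is a direct sum of modules $S^\lambda U$, on which $\mathfrak u^+$ acts locally finitely and $\mathrm{Id}_V$ acts by $\nu$ (this does not depend on the splitting). $Ind$-$(\underline{Rep}(S_\nu)\boxtimes O^{\mathfrak p}_{\nu,V})$ is the category of Ind-objects of $\underline{Rep}(S_\nu)$ with an action of $\mathfrak{gl}(V)$ satisfying the analogous conditions (decomposition $\bigoplus_iY_i\otimes E_i$ with $E_i$ polynomial $\mathfrak{gl}(U)$-modules, $\mathcal U(\mathfrak u^+)$ locally finite, $\mathrm{Id}_V$ acting by $\nu$); its morphisms are the $\mathfrak{gl}(V)$-equivariant ones. **Complex tensor power.** With a splitting $V=\mathbb Ce\oplus U$,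 $V^{\underline\otimes\nu}:=\bigoplus_{k\ge0}(U^{\otimes k}\otimes\Delta_k)^{S_k}$, with $\mathfrak{gl}(V)$-action: $\mathrm{Id}_V$ acts by $\nu$; $A\in\mathfrak{gl}(U)$ acts on the $k$-th summand by $\sum_{i}A^{(i)}\otimes\mathrm{Id}_{\Delta_k}$; $u\in U\cong\mathfrak u^-$ acts by $F_u=\frac1{k+1}\sum_{l=1}^{k+1}u^{(l)}\otimes res_l^*$ from summand $k$ to $k+1$, where $u^{(l)}$ inserts $u$ in position $l$; $f\in U^*\cong\mathfrak u^+$ acts by $E_f=\sum_{l=1}^kf^{(l)}\otimes res_l$ from summand $k$ to $k-1$ (zero for $k=0$), where $f^{(l)}$ contracts the $l$-th tensor factor with $f$. **The canonical morphism.** Given two splittings, define $p:U\to W$ and $c\in U^*$ by $u=p(u)+c(u)e$. The matrix coefficient of $(\mathrm{Id}_V)^{\underline\otimes\nu}$ from $(U^{\otimes k}\otimes\Delta_k)^{S_k}$ to $(W^{\otimes l}\otimes\Delta_l)^{S_l}$ is the restriction of $$\sum_{\iota:\{1,\dots,l\}\to\{1,\dots,k\}\text{ strictly increasing}}p^{(\mathrm{Im}\,\iota)}\otimes c^{(\{1,\dots,k\}\setminus\mathrm{Im}\,\iota)}\otimes res_\iota,$$ where $p^{(\mathrm{Im}\,\iota)}$ applies $p$ to the tensor factors in positions $\iota(1),\dots,\iota(l)$, and $c^{(\{1,\dots,k\}\setminus\mathrm{Im}\,\iota)}$ applies $c$ to the remaining factors (the empty sum, when $l>k$, is zero).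
   Formalization: In the composition rule of Rep(S_ν), the sum over τ coarser than or equal to ρ⋆π is restricted to τ that merge only parts of ρ⋆π not meeting the middle row; as displayed, the rule gives id∘π = π + id for π = {1},{1'}, so it defines no category. *)

(* Defs.v *)
From HB Require Import structures.
From mathcomp Require Import all_boot all_order all_algebra all_fingroup.
Set Implicit Arguments.
Unset Strict Implicit.
Unset Printing Implicit Defensive.
Import Order.TTheory GRing.Theory Num.Theory.
Local Open Scope ring_scope.

(* Indices are 0-based throughout.  The base field K is meant to be R[i] with
   R : realType; only its characteristic 0 matters for the definitions.       *)

Section Diagrams.
Variables r s : nat.

(* inl i is the unprimed (source) element i, inr j the primed (target)
   element j'.                                                                *)
Definition is_pbar (P : {set {set 'I_r + 'I_s}}) : bool :=
  partition P [set: 'I_r + 'I_s] &&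
  [forall B in P, (#|[set i | inl i \in B]| <= 1)%N &&
                  (#|[set j | inr j \in B]| <= 1)%N].

Definition pbar := {P : {set {set 'I_r + 'I_s}} | is_pbar P}.

Definition diag (m : 'I_r -> 'I_s -> bool) : {set {set 'I_r + 'I_s}} :=
  [set [set inl p.1; inr p.2] | p : 'I_r * 'I_s & m p.1 p.2]
  :|: [set [set inl i] | i : 'I_r & [forall j, ~~ m i j]]
  :|: [set [set inr j] | j : 'I_s & [forall i, ~~ m i j]].

Lemma diag_pbar (m : 'I_r -> 'I_s -> bool) :
  (forall i j j', m i j -> m i j' -> j = j') ->
  (forall i i' j, m i j -> m i' j -> i = i') -> is_pbar (diag m).
Proof.
move=> m_fun m_inj.
pose R (x y : 'I_r + 'I_s) : bool := (x == y) ||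
  match x, y with inl i, inr j | inr j, inl i => m i j | _, _ => false end.
have eqR : {in [set: 'I_r + 'I_s] & &, equivalence_rel R}.
  move=> x y z _ _ _; rewrite /R eqxx /=; split=> // /predU1P[->//|].
  case: x y z => [i|j] [i'|j'] [i''|j''] // mij; rewrite ?mij ?orbF ?orbT //=.
  - apply/eqP/idP=> [[<-]//|mi]; by rewrite (m_inj _ _ _ mij mi).
  - apply/idP/eqP=> [mi|[<-]//]; by rewrite (m_fun _ _ _ mij mi).
  - apply/idP/eqP=> [mi|[<-]//]; by rewrite (m_inj _ _ _ mij mi).
  - apply/eqP/idP=> [[<-]//|mi]; by rewrite (m_fun _ _ _ mij mi).
have diagE : diag m = equivalence_partition R setT.
  apply/setP=> B; rewrite !inE; apply/idP/imsetP.
  - move=> /orP[/orP[]|] /imsetP[].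
    + case=> i j; rewrite inE /= => mij ->; exists (inl i) => //.
      apply/setP=> -[i'|j']; rewrite !inE /R /= ?orbF; first by rewrite eq_sym.
      by apply/eqP/idP=> [[->]//|/(m_fun _ _ _ mij) ->].
    + move=> i; rewrite inE => /forallP mi ->; exists (inl i) => //.
      apply/setP=> -[i'|j']; rewrite !inE /R /= ?orbF; first by rewrite eq_sym.
      by apply/esym/negbTE/mi.
    + move=> j; rewrite inE => /forallP mj ->; exists (inr j) => //.
      apply/setP=> -[i'|j']; rewrite !inE /R /= ?orbF; last by rewrite eq_sym.
      by apply/esym/negbTE/mj.
  - case=> -[i|j] _ ->.
    + have [j mij|no] := pickP (m i).
      * apply/orP; left; apply/orP; left; apply/imsetP.
        exists (i, j); rewrite ?inE //.
        apply/setP=> -[i'|j']; rewrite !inE /R /= ?orbF; first by rewrite eq_sym.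
        by apply/idP/eqP=> [/(m_fun _ _ _ mij) ->|[->]].
      * apply/orP; left; apply/orP; right; apply/imsetP.
        exists i; first by rewrite inE; apply/forallP=> j; rewrite no.
        by apply/setP=> -[i'|j']; rewrite !inE /R /= ?orbF ?no // eq_sym.
    + have [i mij|no] := pickP (m^~ j).
      * apply/orP; left; apply/orP; left; apply/imsetP.
        exists (i, j); rewrite ?inE //.
        apply/setP=> -[i'|j']; rewrite !inE /R /= ?orbF; last by rewrite eq_sym.
        by apply/idP/eqP=> [/(m_inj _ _ _ mij) ->|[->]].
      * apply/orP; right; apply/imsetP.
        exists j; first by rewrite inE; apply/forallP=> i; rewrite no.
        by apply/setP=> -[i'|j']; rewrite !inE /R /= ?orbF ?no // eq_sym.
apply/andP; split; first by rewrite diagE; apply: equivalence_partitionP.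
apply/forall_inP=> B; rewrite !inE => /orP[/orP[]|] /imsetP[x _ ->];
  apply/andP; split; apply/card_le1_eqP=> a b;
  by rewrite !inE ?orbF //= => /eqP[->] /eqP[->].
Qed.

End Diagrams.

Section Gluing.
Variables r s t : nat.
Implicit Types (pi : {set {set 'I_r + 'I_s}}) (rho : {set {set 'I_s + 'I_t}}).

Definition rows := ('I_r + 'I_s + 'I_t)%type.

Definition upper (x : 'I_r + 'I_s) : rows := inl x.
Definition lower (y : 'I_s + 'I_t) : rows :=
  match y with inl j => inl (inr j) | inr l => inr l end.
Definition middle (j : 'I_s) : rows := inl (inr j).
Definition outer (x : 'I_r + 'I_t) : rows :=
  match x with inl i => inl (inl i) | inr l => inr l end.

Definition glued rho pi : rel rows := fun x y =>
  [exists B in pi, (x \in upper @: B) && (y \in upper @: B)] ||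
  [exists B in rho, (x \in lower @: B) && (y \in lower @: B)].

Definition linked rho pi : rel rows := connect (glued rho pi).

Definition star rho pi : {set {set 'I_r + 'I_t}} :=
  equivalence_partition (fun x y => linked rho pi (outer x) (outer y)) setT.

Definition nmid rho pi : nat :=
  #|[set B in equivalence_partition (linked rho pi) setT
      | B \subset [set middle j | j : 'I_s]]|.

Definition coarser (T : finType) (P Q : {set {set T}}) : bool :=
  [forall B in P, [exists C in Q, B \subset C]].

(* The partitions tau contributing to rho o pi: tau is coarser than or equal
   to rho * pi, and only parts of rho * pi that do not meet the middle row may
   be merged.  The second condition is forced: a diagram stands for the orbit
   indicator of pairs of injections (f, g) with f i = g j exactly when i and
   j' share a part, so a source (or target) element joined to some middle
   element is distinct from every target (or source) element not joined to
   it.  Without it the diagram with parts {i, i'} is not the identity.        *)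
Definition contributes rho pi (tau : {set {set 'I_r + 'I_t}}) : bool :=
  coarser (star rho pi) tau &&
  [forall B in star rho pi,
    [exists x in B, [exists j, linked rho pi (outer x) (middle j)]]
      ==> (B \in tau)].

End Gluing.

Section Deligne.
Variables (K : numFieldType) (nu : K).

Definition dhom (r s : nat) := {ffun pbar r s -> K^o}.

Definition dbasis r s (D : {set {set 'I_r + 'I_s}}) : dhom r s :=
  [ffun P => (val P == D)%:R].

Definition dcoef r s t (rho : {set {set 'I_s + 'I_t}})
    (pi : {set {set 'I_r + 'I_s}}) (tau : {set {set 'I_r + 'I_t}}) : K :=
  if contributes rho pi tau
  then \prod_(j < nmid rho pi) (nu - #|tau|%:R - j%:R) else 0.

Definition dcomp r s t (g : dhom s t) (f : dhom r s) : dhom r t :=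
  [ffun tau => \sum_rho \sum_pi
     g rho * f pi * dcoef (val rho) (val pi) (val tau)].

Lemma dcomp_suml r s t (I : finType) (P : pred I) (g : I -> dhom s t)
    (f : dhom r s) :
  dcomp (\sum_(i | P i) g i) f = \sum_(i | P i) dcomp (g i) f.
Proof.
apply/ffunP=> tau; rewrite sum_ffunE !ffunE.
under [RHS]eq_bigr => i _ do rewrite ffunE.
rewrite [RHS]exchange_big; apply: eq_bigr => rho _.
rewrite [RHS]exchange_big; apply: eq_bigr => pi _.
by rewrite sum_ffunE !mulr_suml.
Qed.

Lemma dcomp_sumr r s t (I : finType) (P : pred I) (g : dhom s t)
    (f : I -> dhom r s) :
  dcomp g (\sum_(i | P i) f i) = \sum_(i | P i) dcomp g (f i).
Proof.
apply/ffunP=> tau; rewrite sum_ffunE !ffunE.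
under [RHS]eq_bigr => i _ do rewrite ffunE.
rewrite [RHS]exchange_big; apply: eq_bigr => rho _.
rewrite [RHS]exchange_big; apply: eq_bigr => pi _.
by rewrite sum_ffunE mulr_sumr mulr_suml.
Qed.

Lemma dcompZl r s t (a : K) (g : dhom s t) (f : dhom r s) :
  dcomp (a *: g) f = a *: dcomp g f.
Proof.
apply/ffunP=> tau; rewrite !ffunE scaler_sumr; apply: eq_bigr => rho _.
rewrite scaler_sumr; apply: eq_bigr => pi _.
by rewrite !ffunE /GRing.scale /= !mulrA.
Qed.

Lemma dcompZr r s t (a : K) (g : dhom s t) (f : dhom r s) :
  dcomp g (a *: f) = a *: dcomp g f.
Proof.
apply/ffunP=> tau; rewrite !ffunE scaler_sumr; apply: eq_bigr => rho _.
rewrite scaler_sumr; apply: eq_bigr => pi _.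
by rewrite !ffunE /GRing.scale /= !mulrA [_ * a]mulrC.
Qed.

Lemma dcomp0l r s t (f : dhom r s) : dcomp (0 : dhom s t) f = 0.
Proof. by rewrite -(scale0r (0 : dhom s t)) dcompZl scale0r. Qed.

Lemma dcomp0r r s t (g : dhom s t) : dcomp g (0 : dhom r s) = 0.
Proof. by rewrite -(scale0r (0 : dhom r s)) dcompZr scale0r. Qed.

(* Additive envelope: a finite family (k_i) of natural numbers stands for
   \bigoplus_i Delta_(k_i); the tensor product of a vector space with basis I
   and Delta_k is the constant family k indexed by I.                         *)
Record aob := Aob { aidx : finType; adeg : aidx -> nat }.

Record ahom (X Y : aob) := AHom {
  aent :> forall (i : aidx X) (j : aidx Y), dhom (adeg i) (adeg j) }.

Definition aeq (X Y : aob) (f g : ahom X Y) : Prop := forall i j, f i j = g i j.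

Definition azero (X Y : aob) : ahom X Y := AHom (fun _ _ => 0).

Definition aadd (X Y : aob) (f g : ahom X Y) : ahom X Y :=
  AHom (fun i j => f i j + g i j).

Definition acomp (X Y Z : aob) (g : ahom Y Z) (f : ahom X Y) : ahom X Z :=
  AHom (fun i k => \sum_j dcomp (g j k) (f i j)).

(* Karoubi envelope: objects of Rep(S_nu).                                    *)
Record kob := Kob {
  kbase :> aob;
  kidem : ahom kbase kbase;
  kidemP : aeq (acomp kidem kidem) kidem }.

(* The morphisms X -> Y of Rep(S_nu) are the f : ahom X Y with is_khom f; they
   compose by acomp, and the identity of X is kidem X.                        *)
Definition is_khom (X Y : kob) (f : ahom X Y) : Prop :=
  aeq (acomp (kidem Y) f) f /\ aeq (acomp f (kidem X)) f.

(* Filtered systems in Rep(S_nu), indexed by a nonempty directed preorder;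
   every Ind-object is presented by such a system.                            *)
Record indob := Indob {
  iidx : Type;
  ile : iidx -> iidx -> Prop;
  ile_refl : forall i, ile i i;
  ile_trans : forall i j k, ile i j -> ile j k -> ile i k;
  ile_dir : forall i j, exists k, ile i k /\ ile j k;
  iidx_inh : inhabited iidx;
  istage : iidx -> kob;
  itr : forall i j, ile i j -> ahom (istage i) (istage j);
  itr_id : forall i (h : ile i i), aeq (itr h) (kidem (istage i));
  itr_comp : forall i j k (hij : ile i j) (hjk : ile j k) (hik : ile i k),
    aeq (acomp (itr hjk) (itr hij)) (itr hik) }.

(* Representatives of elements of lim_i colim_j Hom(X_i, Y_j): is_imor says
   that the components are morphisms of Rep(S_nu) that form a compatible
   family of germs, ieq that two representatives define the same element.     *)
Record imor (X Y : indob) := Imor {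
  itgt : iidx X -> iidx Y;
  imap : forall i, ahom (istage i) (istage (itgt i)) }.

Definition is_imor (X Y : indob) (f : imor X Y) : Prop :=
  (forall i, is_khom (imap f i)) /\
  (forall i i' (h : ile i i'), exists j,
     exists (hj : ile (itgt f i) j) (hj' : ile (itgt f i') j),
       aeq (acomp (itr hj) (imap f i))
           (acomp (itr hj') (acomp (imap f i') (itr h)))).

Definition ieq (X Y : indob) (f g : imor X Y) : Prop :=
  forall i, exists j, exists (hf : ile (itgt f i) j) (hg : ile (itgt g i) j),
    aeq (acomp (itr hf) (imap f i)) (acomp (itr hg) (imap g i)).

Definition iid (X : indob) : imor X X :=
  @Imor X X id (fun i => kidem (istage i)).

Definition icomp (X Y Z : indob) (g : imor Y Z) (f : imor X Y) : imor X Z :=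
  @Imor X Z (fun i => itgt g (itgt f i))
            (fun i => acomp (imap g (itgt f i)) (imap f i)).

Definition ind_iso (X Y : indob) (f : imor X Y) : Prop :=
  is_imor f /\ exists g : imor Y X,
    [/\ is_imor g, ieq (icomp g f) (iid X) & ieq (icomp f g) (iid Y)].

Section DirectSum.

(* The morphism with target index m placed in a family of morphisms indexed
   by all possible target indices l, zero for l != m.                         *)
Definition place (A : aob) (Y : nat -> aob) m (g : ahom A (Y m)) l :
    ahom A (Y l) :=
  if m =P l is ReflectT E then eq_rect m (fun l => ahom A (Y l)) g l E
  else azero A (Y l).

Definition apsum (X : nat -> aob) (n : nat) : aob :=
  @Aob {k : 'I_n & aidx (X k)} (fun u => adeg (tagged u)).

Definition blocks (X Y : nat -> aob) (c : forall k l, ahom (X k) (Y l)) m n :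
    ahom (apsum X m) (apsum Y n) :=
  @AHom (apsum X m) (apsum Y n)
    (fun u v => c (tag u) (tag v) (tagged u) (tagged v)).

Variable X : nat -> kob.

Definition idfam k : forall l, ahom (X k) (X l) :=
  place (Y := X) (kidem (X k)).

Lemma blocks_idfam_comp m n p : (m <= n)%N ->
  aeq (acomp (blocks idfam n p) (blocks idfam m n)) (blocks idfam m p).
Proof.
move=> le_mn [k x] [l z] /=.
rewrite -(sig_big_dep (fun _ => true) (fun _ _ => true)
  (fun (k' : 'I_n) (y : aidx (X k')) =>
     dcomp (idfam k' l y z) (idfam k k' x y))) /=.
rewrite (bigD1 (widen_ord le_mn k)) //= addrC big1 ?add0r => [|k' k'k].
  rewrite /idfam {2}/place; case: eqP => // E; rewrite (eq_axiomK E) /=.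
  rewrite /place; case: eqP => [E'|_]; last first.
    by rewrite big1 // => y _; apply: dcomp0l.
  by move: (nat_of_ord l) E' z => l' E'; case: _ / E' => z; apply: kidemP.
rewrite big1 // => y _; rewrite [idfam k k']/idfam /place; case: eqP => [E|_].
  by case/eqP: k'k; apply: val_inj; rewrite /= -E.
exact: dcomp0r.
Qed.

Definition psum (n : nat) : kob := Kob (@blocks_idfam_comp n n n (leqnn n)).

Lemma leq_dir i j : exists k, (i <= k)%N /\ (j <= k)%N.
Proof. by exists (maxn i j); rewrite leq_maxl leq_maxr. Qed.

(* \bigoplus_(k >= 0) X k, as the filtered system of the X 0 + ... + X (n-1)
   and their inclusions.                                                      *)
Definition dsum : indob :=
  @Indob nat (fun m n => (m <= n)%N) leqnn (fun i j k => @leq_trans j i k)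
    leq_dir (inhabits 0%N) psum (fun m n _ => blocks idfam m n)
    (fun i _ u v => erefl)
    (fun i j k hij _ _ => @blocks_idfam_comp i j k hij).

End DirectSum.

(* The morphism dsum X -> dsum Y with matrix coefficients c k l : X k -> Y l,
   where the coefficients out of X 0, ..., X (n-1) land in Y 0, ...,
   Y (b n - 1).                                                               *)
Definition dmor (X Y : nat -> kob) (c : forall k l, ahom (X k) (Y l))
    (b : nat -> nat)
    (_ : forall n k l, (k < n)%N -> (b n <= l)%N -> aeq (c k l) (@azero _ _)) :
    imor (dsum X) (dsum Y) :=
  @Imor (dsum X) (dsum Y) b (fun n => blocks c n (b n)).

(* U^{\otimes k} \otimes Delta_k for a space U with basis (u_i)_(i < d): the
   word w is the basis tensor u_(w 0) (x) ... (x) u_(w (k-1)).                *)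
Definition tens (d k : nat) : aob := @Aob {ffun 'I_k -> 'I_d} (fun _ => k).

Definition dperm k (sigma : 'S_k) : dhom k k :=
  dbasis (diag (fun i j => sigma i == j)).

Lemma diag_perm k (sigma : 'S_k) :
  diag (fun i j => sigma i == j) = [set [set inl i; inr (sigma i)] | i : 'I_k].
Proof.
apply/setP=> B; rewrite !inE; apply/idP/imsetP=> [|[i _ ->]].
  case/orP=> [/orP[]|] /imsetP[].
  - by case=> i j; rewrite inE /= => /eqP<- ->; exists i.
  - by move=> i; rewrite inE => /forallP/(_ (sigma i)); rewrite eqxx.
  - by move=> j; rewrite inE => /forallP/(_ (sigma^-1 j)%g); rewrite permKV eqxx.
apply/orP; left; apply/orP; left; apply/imsetP.
by exists (i, sigma i); rewrite ?inE /=.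
Qed.

Lemma dcomp_perm k (sigma tau : 'S_k) :
  dcomp (dperm sigma) (dperm tau) = dperm (tau * sigma)%g.
Proof.
have perm_pbar (s : 'S_k) : is_pbar (diag (fun i j => s i == j)).
  by apply: diag_pbar => [i j j' /eqP<- /eqP|i i' j /eqP<- /eqP/perm_inj].
set D := fun s : 'S_k => diag (fun i j => s i == j).
have -> : dcomp (dperm sigma) (dperm tau) =
    [ffun T => dcoef (D sigma) (D tau) (val T)].
  apply/ffunP=> T; rewrite !ffunE.
  pose DP s : pbar k k := exist _ (D s) (perm_pbar s).
  rewrite (bigD1 (DP sigma)) //= [X in _ + X]big1.
    rewrite addr0 (bigD1 (DP tau)) //= big1.
      by rewrite !ffunE /= !eqxx !mul1r addr0.
    move=> P; rewrite -val_eqE /= => /negbTE neP.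
    by rewrite !ffunE /= neP mulr0 mul0r.
  move=> P; rewrite -val_eqE /= => /negbTE neP.
  by rewrite big1 // => Q _; rewrite !ffunE /= neP !mul0r.
pose cl (x : rows k k k) : 'I_k := match x with
  | inl (inl i) => i
  | inl (inr j) => (tau^-1 j)%g
  | inr l => ((tau * sigma)^-1 l)%g end.
pose G := glued (D sigma) (D tau).
have G_sym : symmetric G.
  by move=> x y; congr (_ || _); apply: eq_existsb => B;
    rewrite [X in _ && X]andbC.
have G_cl x y : G x y -> cl x = cl y.
  case/orP=> /exists_inP[B]; rewrite /D diag_perm => /imsetP[i _ ->] /andP[].
    by case/imsetP=> a; rewrite !inE => /orP[]/eqP-> ->;
       case/imsetP=> b; rewrite !inE => /orP[]/eqP-> -> /=; rewrite ?permK.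
  by case/imsetP=> a; rewrite !inE => /orP[]/eqP-> ->;
     case/imsetP=> b; rewrite !inE => /orP[]/eqP-> -> /=;
     rewrite ?invMg ?permM ?permK.
have G_mid x : G x (middle k k (tau (cl x))).
  case: x => [[i|j]|l] /=; apply/orP.
  - left; apply/exists_inP; exists [set inl i; inr (tau i)].
      by rewrite /D diag_perm; apply: imset_f.
    by apply/andP; split; apply/imsetP;
       [exists (inl i) | exists (inr (tau i))]; rewrite ?inE ?eqxx ?orbT.
  - left; apply/exists_inP; exists [set inl (tau^-1 j)%g; inr j].
      rewrite /D diag_perm; apply/imsetP; exists (tau^-1 j)%g => //.
      by rewrite permKV.
    by apply/andP; split; apply/imsetP; exists (inr j);
       rewrite ?permKV ?inE ?eqxx ?orbT.
  - right; apply/exists_inP; exists [set inl (sigma^-1 l)%g; inr l].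
      rewrite /D diag_perm; apply/imsetP; exists (sigma^-1 l)%g => //.
      by rewrite permKV.
    by apply/andP; split; apply/imsetP;
       [exists (inr l) | exists (inl (sigma^-1 l)%g)];
       rewrite ?invMg ?permM ?permKV ?inE ?eqxx ?orbT.
have linkE x y : linked (D sigma) (D tau) x y = (cl x == cl y).
  apply/idP/eqP=> [/connectP[p]|eq_cl].
    by elim: p x => [|z p IH] x /= => [_ ->|/andP[/G_cl-> /IH]].
  apply: connect_trans (connect1 (G_mid x)) _.
  by rewrite -/G (sym_connect_sym G_sym) eq_cl; apply: connect1.
have starE : star (D sigma) (D tau) = D (tau * sigma)%g.
  rewrite [D (tau * sigma)%g]diag_perm; apply/setP=> B.
  have blk i : [set y in [set: 'I_k + 'I_k] | linked (D sigma) (D tau)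
      (outer k (inl i)) (outer k y)] = [set inl i; inr ((tau * sigma)%g i)].
    apply/setP=> -[i'|l]; rewrite !inE linkE /= ?orbF 1?eq_sym //.
    by rewrite (can2_eq (permKV _) (permK _)).
  apply/imsetP/imsetP=> [[x _ ->]|[i _ ->]]; last by exists (inl i); rewrite ?blk.
  exists (cl (outer k x)) => //; rewrite -blk; apply/setP=> y.
  by rewrite !inE !linkE.
have nmidE : nmid (D sigma) (D tau) = 0%N.
  apply/eqP; rewrite cards_eq0; apply/eqP/setP=> B; rewrite !inE.
  apply/negP=> /andP[/imsetP[x _ ->] /subsetP/(_ (inl (inl (cl x))))].
  by rewrite !inE linkE eqxx => /(_ isT)/imsetP[].
apply/ffunP=> -[T T_pbar]; rewrite !ffunE /dcoef nmidE big_ord0 -/(D _) /=.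
suff -> : contributes (D sigma) (D tau) T = (T == D (tau * sigma)%g).
  by case: ifP.
rewrite /contributes starE; apply/idP/eqP=> [/andP[_ /forall_inP sub]|->].
  have subT B : B \in D (tau * sigma)%g -> B \in T.
    move=> BD; apply: (implyP (sub B BD)).
    move: BD; rewrite /D diag_perm => /imsetP[i _ ->].
    apply/exists_inP; exists (inl i); first by rewrite !inE eqxx.
    by apply/existsP; exists (tau i); rewrite linkE /= permK.
  apply/esym/eqP; rewrite eqEsubset; apply/andP; split; first exact/subsetP.
  have /andP[/and3P[_ /trivIsetP T_triv T0] _] := T_pbar.
  have /andP[/and3P[/eqP covD _ _] _] := perm_pbar (tau * sigma)%g.
  apply/subsetP=> C CT; have [x xC] : exists x, x \in C.
    by apply/set0Pn; apply: contraNneq T0 => <-.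
  have /bigcupP[B BD xB] : x \in cover (D (tau * sigma)%g) by rewrite covD.
  suff -> : C = B by [].
  apply/eqP; apply: contraT => /(T_triv _ _ CT (subT _ BD))/pred0P/(_ x).
  by rewrite /= xC xB.
apply/andP; split; apply/forall_inP=> B BD; last by rewrite BD implybT.
by apply/exists_inP; exists B.
Qed.

(* Averaging over the diagonal action of S_k on U^{\otimes k} \otimes Delta_k;
   its image is the object of S_k-invariants.                                 *)
Definition symz d k : ahom (tens d k) (tens d k) :=
  @AHom (tens d k) (tens d k) (fun w w' =>
    (k`!%:R)^-1 *: \sum_(sigma : 'S_k | [forall i, w' (sigma i) == w i])
                     dperm sigma).

Lemma symz_idem d k : aeq (acomp (symz d k) (symz d k)) (symz d k).
Proof.
move=> w w2 /=.
under eq_bigr => w1 _ do rewrite dcompZl dcompZr dcomp_suml big_mkcond /=.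
rewrite -!scaler_sumr exchange_big /=.
rewrite (eq_bigr (fun _ : 'S_k =>
  \sum_(tau : 'S_k | [forall i, w2 (tau i) == w i]) dperm tau)); last first.
  move=> sigma _.
  rewrite (bigD1 [ffun i => w2 (sigma i)]) //= [X in _ + X]big1 ?addr0.
    rewrite ifT; last by apply/forallP=> i; rewrite ffunE.
    rewrite dcomp_sumr [RHS](reindex_inj (mulIg sigma)) /=.
    apply: eq_big => [tau|tau _]; last exact: dcomp_perm.
    by apply: eq_forallb => i; rewrite ffunE permM.
  move=> w1 w1E; case: ifP => // /forallP w2E; case/eqP: w1E.
  by apply/ffunP=> i; rewrite ffunE (eqP (w2E i)).
rewrite sumr_const card_Sn -scaler_nat !scalerA; congr (_ *: _).
by rewrite -mulrA mulVf ?mulr1 // pnatr_eq0 -lt0n fact_gt0.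
Qed.

Definition sinv d k : kob := Kob (@symz_idem d k).

Definition dres k l (iota : 'I_l -> 'I_k) : dhom k l :=
  dbasis (diag (fun i j => i == iota j)).

Definition dres_star k (l : 'I_k.+1) : dhom k k.+1 :=
  dbasis (diag (fun i j => lift l i == j)).

Definition incr k l (iota : {ffun 'I_l -> 'I_k}) : bool :=
  [forall i : 'I_l, [forall j : 'I_l, (i < j)%N ==> (iota i < iota j)%N]].

End Deligne.

Record splitting (K : fieldType) (V : vectType K) (e : V) := Splitting {
  spl_space :> {vspace V};
  spl_full : (<[e]> + spl_space)%VS = fullv;
  spl_direct : directv (<[e]> + spl_space) }.

Section TensorPower.
Variables (K : numFieldType) (nu : K) (V : vectType K) (e : V).
Implicit Types (U W : splitting e) (phi : 'End(V)) (v : V).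

(* v = spl_pr U v + spl_ec U v *: e, with spl_pr U v in U.                    *)
Definition spl_pr U v : V := daddv_pi U <[e]> v.
Definition spl_ec U v : K := coord [tuple e] ord0 (daddv_pi <[e]> U v).

Lemma spl_eq U v : e != 0 ->
  v = spl_pr U v + spl_ec U v *: e /\ spl_pr U v \in (U : {vspace V}).
Proof.
move=> e0; split; last exact: memv_pi.
have /directv_addP dU := spl_direct U.
rewrite {1}(_ : v = spl_pr U v + daddv_pi <[e]> U v); last first.
  by rewrite addrC daddv_pi_add // spl_full memvf.
have /vlineP[a Ea] : daddv_pi <[e]> U v \in <[e]>%VS by apply: memv_pi.
rewrite /spl_ec Ea linearZ /=; congr (_ + _ *: _).
have/(coord_free ord0 ord0) /= -> : free [tuple e] by rewrite seq1_free.
by rewrite mulr1.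
Qed.

Definition ubase U (i : 'I_(\dim U)) : V := (vbasis U)`_i.
Definition ucoord U (i : 'I_(\dim U)) v : K := coord (vbasis U) i v.

(* The complex tensor power of V along the splitting U.                       *)
Definition cpow U : indob nu := dsum (sinv nu (\dim U)).

(* Components of phi in K Id + u^- + u^+ + gl(U), so that
   phi e = gl_a *: e + gl_u  and  phi v = gl_a *: v + gl_A v + gl_f v *: e
   for v in U.                                                                *)
Definition gl_a U phi : K := spl_ec U (phi e).
Definition gl_u U phi : V := spl_pr U (phi e).
Definition gl_f U phi v : K := spl_ec U (phi v).
Definition gl_A U phi v : V := spl_pr U (phi v) - gl_a U phi *: v.

(* The operators below are given on the whole of U^{\otimes k} \otimes Delta_k
   and restricted to the invariants by precomposing with symz.                *)

Definition op0 U phi k : ahom K (tens (\dim U) k) (tens (\dim U) k) :=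
  @AHom K (tens (\dim U) k) (tens (\dim U) k) (fun w w' =>
    (gl_a U phi * nu * (w == w')%:R +
     \sum_(i < k | [forall (j | j != i), w' j == w j])
        ucoord (w' i) (gl_A U phi (ubase (w i)))) *: dperm K 1).

Definition opF U phi k : ahom K (tens (\dim U) k) (tens (\dim U) k.+1) :=
  @AHom K (tens (\dim U) k) (tens (\dim U) k.+1) (fun w w' =>
    (k.+1%:R)^-1 *: \sum_(l : 'I_k.+1 | [forall i, w' (lift l i) == w i])
                      ucoord (w' l) (gl_u U phi) *: dres_star K l).

Definition opE U phi k : ahom K (tens (\dim U) k.+1) (tens (\dim U) k) :=
  @AHom K (tens (\dim U) k.+1) (tens (\dim U) k) (fun w w' =>
    \sum_(l : 'I_k.+1 | [forall i, w' i == w (lift l i)])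
       gl_f U phi (ubase (w l)) *: dres K (lift l)).

Definition opE_out U phi k : forall l, ahom K (tens (\dim U) k) (tens (\dim U) l) :=
  match k with
  | 0 => fun l => @azero K _ _
  | k'.+1 => place (Y := tens (\dim U)) (@opE U phi k')
  end.

Definition act_coef U phi k l : ahom K (tens (\dim U) k) (tens (\dim U) l) :=
  acomp nu
    (aadd (place (Y := tens (\dim U)) (@op0 U phi k) l)
       (aadd (place (Y := tens (\dim U)) (@opF U phi k) l)
             (@opE_out U phi k l)))
    (@symz K (\dim U) k).

Lemma act_coef_bound U phi n k l : (k < n)%N -> (n.+1 <= l)%N ->
  aeq (@act_coef U phi k l) (@azero K _ _).
Proof.
move=> lt_kn lt_nl; have lt_k1l := leq_ltn_trans lt_kn lt_nl.
have place0 m A g : (m < l)%N ->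
    aeq (@place K A (tens (\dim U)) m g l) (@azero K _ _).
  rewrite /place => lt_ml; case: eqP => // eq_ml.
  by have := lt_ml; rewrite {1}eq_ml ltnn.
have opE0 : aeq (@opE_out U phi k l) (@azero K _ _).
  case: k lt_k1l {lt_kn} => [|k] lt_k1l //=.
  by apply: place0; rewrite -ltnS ltnW // ltnW.
move=> w w' /=; rewrite big1 // => w1 _.
by rewrite opE0 !place0 ?(ltnW lt_k1l) // !addr0 dcomp0l.
Qed.

Definition act U phi : imor (cpow U) (cpow U) :=
  dmor (X := sinv nu (\dim U)) (Y := sinv nu (\dim U)) (@act_coef_bound U phi).

(* For u in U, u = p u + c u *: e with p := spl_pr W, c := spl_ec W.          *)
Definition canon_full U W k l : ahom K (tens (\dim U) k) (tens (\dim W) l) :=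
  @AHom K (tens (\dim U) k) (tens (\dim W) l) (fun w w' =>
    \sum_(iota : {ffun 'I_l -> 'I_k} | incr iota)
      ((\prod_(i < l) ucoord (w' i) (spl_pr W (ubase (w (iota i))))) *
       (\prod_(j < k | j \notin codom iota) spl_ec W (ubase (w j))))
      *: dres K iota).

Definition canon_coef U W k l : ahom K (tens (\dim U) k) (tens (\dim W) l) :=
  acomp nu (@canon_full U W k l) (@symz K (\dim U) k).

Lemma canon_coef_bound U W n k l : (k < n)%N -> (n <= l)%N ->
  aeq (@canon_coef U W k l) (@azero K _ _).
Proof.
move=> lt_kn le_nl w w' /=; rewrite big1 // => w1 _.
rewrite big_pred0 ?dcomp0l // => iota; apply/negbTE/negP=> inc.
have le_i j : forall lt_jl : (j < l)%N, (j <= iota (Ordinal lt_jl))%N.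
  elim: j => // j IH lt_jl; apply: leq_ltn_trans (IH (ltnW lt_jl)) _.
  by move/forallP/(_ (Ordinal (ltnW lt_jl)))/forallP/(_ (Ordinal lt_jl)): inc;
    rewrite /= ltnSn.
have lt_kl := leq_trans lt_kn le_nl.
by have := le_i k lt_kl; rewrite leqNgt ltn_ord.
Qed.

Definition canon U W : imor (cpow U) (cpow W) :=
  dmor (X := sinv nu (\dim U)) (Y := sinv nu (\dim W)) (@canon_coef_bound U W).

End TensorPower.

(* Main.v *)
Require Import Defs.
From HB Require Import structures.
From mathcomp Require Import all_boot all_order all_algebra fingroup perm.
From mathcomp Require Import complex.
From mathcomp Require Import reals ring.
Set Implicit Arguments.
Unset Strict Implicit.
Unset Printing Implicit Defensive.
Import Order.TTheory GRing.Theory Num.Theory.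
Local Open Scope ring_scope.

(** For a natural number nu = n the object Delta_k consists of the functions
    on injections of k points into n points, the complex tensor power is the
    ordinary V^{(x) n} sorted by the set of factors that are not equal to e,
    and the canonical morphism is the identity of V^{(x) n} read in two such
    decompositions.  The proof is the diagrammatic form of this remark, valid
    for every nu.

    The difficulty is bookkeeping with invariants, and it disappears after one
    change of viewpoint.  Write u = p u + c(u) e for u in U, with p u in W.  In
    the definition the coefficients run over increasing maps and are restricted
    to the S_k-invariants.  On invariants only the image of a map matters, so
    they coincide [canon_symz] with
      C(k, l) = (1 / l!) \sum_f p^{(im f)} (x) c^{(rest)} (x) res_f,
    where f runs over all injections from l points to k points; this makes
    sense on the whole of U^{(x) k} (x) Delta_k.  The family C has three
    properties.
    - For U = W it is the symmetrizer [canon_inj_symz], because p = id and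
      c = 0 leave only the permutations.
    - It is a cocycle in the pair of splittings [canon_inj_comp]: a position
      outside the image of a composite injection is lost at the first or at
      the second step, and the sum over these choices is the expansion of a
      product of sums c(u) + c'(p u), the e-component after both steps.
    - It intertwines the operators of gl(V) before any restriction to
      invariants [canon_inj_intertwines].
    The rest is formal.  The cocycle identity for U, W, U shows that the two
    canonical morphisms are inverse to each other, and the symmetrizers are
    absorbed by the cases U, U, W and U, W, W.  That the operators of gl(V)
    preserve invariants is the intertwining property for U = W.

    The intertwining property rests on three composition laws.  A map res_f
    following res*_m with m outside the image of f closes a component in the
    middle row and gives the scalar nu - k [dcomp_dres_star_skip]; with m in
    the image of f it gives a diagram with an isolated target point
    [dcomp_dres_star_hit]; and res*_j following res_f gives the same diagram
    plus all the ways to merge the isolated target point with an isolated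
    source point [dcomp_star_dres].  The diagrams with an isolated target point
    agree on both sides.  For the coefficients of each res_f, write
    phi e = a e + u and phi v = a v + A v + f(v) e for v in U, and put primes
    for the splitting with W.  Then u' = p u and
      a' = a + c(u),  p A = A' p + c(u) p + (p u) (x) c,
      c A + f = f' p + c(u) c,
    and the k summands c(u) produced by the last two relations make up for the
    k in nu - k.

    Associativity of the composition is needed only for three factors one of
    which is a permutation, where it is a relabelling
    [dcompA_right, dcompA_mid]. *)

(** * Partitions and diagrams *)

Section PartitionRelation.
Variable T : finType.
Implicit Types P Q : {set {set T}}.

Definition same_part P : rel T := fun x y => [exists B in P, (x \in B) && (y \in B)].

Lemma partition_same_part P : partition P setT ->
  P = [set [set y | same_part P x y] | x : T].
Proof.
case/and3P=> /eqP covP trivP P0; apply/setP=> B; apply/idP/imsetP.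
- move=> BP; have [x xB] : exists x, x \in B.
    by apply/set0Pn; apply: contraNneq P0 => <-.
  exists x => //; apply/setP=> y; rewrite inE; apply/idP/exists_inP.
    by move=> yB; exists B => //; rewrite xB.
  case=> C CP /andP[xC yC].
  by rewrite -(def_pblock trivP BP xB) (def_pblock trivP CP xC).
- case=> x _ ->; have xc : x \in cover P by rewrite covP inE.
  have -> : [set y | same_part P x y] = pblock P x; last exact: pblock_mem.
  apply/setP=> y; rewrite inE; apply/exists_inP/idP.
    by case=> C CP /andP[xC yC]; rewrite (def_pblock trivP CP xC).
  by move=> yx; exists (pblock P x); rewrite ?pblock_mem // mem_pblock xc.
Qed.

Lemma part_in P x : partition P setT -> [set y | same_part P x y] \in P.
Proof. move=> pP; have: [set y | same_part P x y] \in [set [set y | same_part P x y] | x : T].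
  exact: imset_f.
by rewrite -partition_same_part. Qed.

Lemma same_partxx P x : partition P setT -> same_part P x x.
Proof.
case/and3P=> /eqP covP trivP P0; apply/exists_inP; exists (pblock P x).
  by rewrite pblock_mem // covP inE.
by rewrite andbb mem_pblock covP inE.
Qed.

Lemma same_part_sym P : symmetric (same_part P).
Proof. by move=> x y; apply: eq_existsb => B; rewrite [X in _ && X]andbC. Qed.

Lemma same_part_trans P : partition P setT -> transitive (same_part P).
Proof.
case/and3P=> /eqP covP trivP P0 y x z /exists_inP[B BP /andP[xB yB]].
case/exists_inP=> C CP /andP[yC zC]; apply/exists_inP; exists B => //.
by rewrite xB -(def_pblock trivP BP yB) (def_pblock trivP CP yC).
Qed.

Lemma same_part_inj P Q : partition P setT -> partition Q setT ->
  (forall x y, same_part P x y = same_part Q x y) -> P = Q.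
Proof.
move=> pP pQ e; rewrite (partition_same_part pP) (partition_same_part pQ).
by apply: eq_imset => x; apply/setP=> y; rewrite !inE e.
Qed.

End PartitionRelation.

(** The incidence matrix of a partial injection; the diagrams in pbar r s are
    exactly these. *)
Definition part_inj r s (m : 'I_r -> 'I_s -> bool) : Prop :=
  (forall i j j', m i j -> m i j' -> j = j') /\
  (forall i i' j, m i j -> m i' j -> i = i').

Lemma part_inj_pbar r s (m : 'I_r -> 'I_s -> bool) :
  part_inj m -> is_pbar (diag m).
Proof. by case; apply: diag_pbar. Qed.

Lemma pbar_partition r s (P : {set {set 'I_r + 'I_s}}) :
  is_pbar P -> partition P setT.
Proof. by case/andP. Qed.

(** The equivalence relation whose classes are the parts of diag m. *)
Definition joins r s (m : 'I_r -> 'I_s -> bool) : rel ('I_r + 'I_s) :=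
  fun x y => (x == y) ||
    match x, y with inl i, inr j | inr j, inl i => m i j | _, _ => false end.

Lemma same_part_diag r s (m : 'I_r -> 'I_s -> bool) x y :
  part_inj m -> same_part (diag m) x y = joins m x y.
Proof.
move=> hm; apply/idP/idP.
- case/exists_inP=> B; rewrite !inE => /orP[/orP[]|] /imsetP[].
  + case=> i j; rewrite inE /= => mij ->.
    by rewrite !inE /joins => /andP[/orP[]/eqP-> /orP[]/eqP->];
      rewrite ?eqxx ?mij ?orbT.
  + by move=> i _ ->; rewrite !inE /joins => /andP[/eqP-> /eqP->]; rewrite eqxx.
  + by move=> i _ ->; rewrite !inE /joins => /andP[/eqP-> /eqP->]; rewrite eqxx.
- case/orP=> [/eqP->|]; first exact/same_partxx/pbar_partition/part_inj_pbar.
  have K i j : m i j -> same_part (diag m) (inl i) (inr j).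
    move=> mij; apply/exists_inP; exists [set inl i; inr j]; last first.
      by rewrite !inE !eqxx orbT.
    by rewrite !inE; apply/orP; left; apply/orP; left; apply/imsetP;
       exists (i, j); rewrite ?inE.
  by case: x y => [i|j] [i'|j'] //; first exact: K; rewrite same_part_sym; apply: K.
Qed.

(** Inverse to diag: together they let a diagram be handled as a partial
    injection. *)
Definition incidence r s (P : {set {set 'I_r + 'I_s}}) : 'I_r -> 'I_s -> bool :=
  fun i j => same_part P (inl i) (inr j).

Lemma pbar_source r s (P : {set {set 'I_r + 'I_s}}) i i' :
  is_pbar P -> same_part P (inl i) (inl i') -> i = i'.
Proof.
case/andP=> _ /forall_inP h /exists_inP[B /h/andP[/card_le1_eqP h1 _]].
by case/andP=> a b; apply: h1; rewrite inE.
Qed.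

Lemma pbar_target r s (P : {set {set 'I_r + 'I_s}}) j j' :
  is_pbar P -> same_part P (inr j) (inr j') -> j = j'.
Proof.
case/andP=> _ /forall_inP h /exists_inP[B /h/andP[_ /card_le1_eqP h1]].
by case/andP=> a b; apply: h1; rewrite inE.
Qed.

Lemma incidence_part_inj r s (P : {set {set 'I_r + 'I_s}}) :
  is_pbar P -> part_inj (incidence P).
Proof.
move=> hP; have tr := same_part_trans (pbar_partition hP).
split=> [i j j'|i i' j] h1 h2.
  by apply: (pbar_target hP); apply: tr h2; rewrite same_part_sym.
by apply: (pbar_source hP); apply: tr h1 _; rewrite same_part_sym.
Qed.

Lemma same_part_incidence r s (P : {set {set 'I_r + 'I_s}}) x y :
  is_pbar P -> same_part P x y = joins (incidence P) x y.
Proof.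
move=> hP; have refl := same_partxx _ (pbar_partition hP).
case: x y => [i|j] [i'|j']; rewrite /joins /incidence ?orbF //=.
- by apply/idP/eqP=> [/(pbar_source hP)->|->].
- by rewrite same_part_sym.
- by apply/idP/eqP=> [/(pbar_target hP)->|->].
Qed.

Lemma diag_incidence r s (P : {set {set 'I_r + 'I_s}}) :
  is_pbar P -> diag (incidence P) = P.
Proof.
move=> hP; have hm := incidence_part_inj hP.
apply: same_part_inj => [||x y]; try exact: pbar_partition.
  exact/pbar_partition/part_inj_pbar.
by rewrite same_part_diag // same_part_incidence.
Qed.

Lemma incidence_diag r s (m : 'I_r -> 'I_s -> bool) i j :
  part_inj m -> incidence (diag m) i j = m i j.
Proof. by move=> hm; rewrite /incidence same_part_diag. Qed.

Lemma eq_diag r s (m m' : 'I_r -> 'I_s -> bool) :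
  m =2 m' -> diag m = diag m'.
Proof.
move=> e; rewrite /diag; congr (_ :|: _ :|: _);
  apply/setP=> B; apply/imsetP/imsetP => -[x hx ->]; exists x => //;
  move: hx; rewrite !inE ?e //; apply: etrans; apply: eq_forallb => y; by rewrite e.
Qed.

(** * Gluing two diagrams *)

Section Composition.
Variables (r s t : nat) (m1 : 'I_r -> 'I_s -> bool) (m2 : 'I_s -> 'I_t -> bool).
Hypotheses (hm1 : part_inj m1) (hm2 : part_inj m2).

(** A connected component of the glued diagram contains at most one middle
    element, which serves as its representative if it exists; a component
    without one is a single outer element. *)
(** A connected component of the glued diagram contains at most one middle
    element, which serves as its representative; a component without one is a
    single outer element, which represents itself. *)
Definition anchor (x : rows r s t) : rows r s t :=
  match x with
  | inl (inl i) => if [pick j | m1 i j] is Some j then middle r t j else x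
  | inl (inr _) => x
  | inr l => if [pick j | m2 j l] is Some j then middle r t j else x
  end.

Definition anchored (x : rows r s t) : bool := [exists j, anchor x == middle r t j].

Lemma anchor_upper i j : m1 i j -> anchor (inl (inl i)) = middle r t j.
Proof.
move=> mij /=; case: pickP => [j' mij'|/(_ j)]; last by rewrite mij.
by rewrite (hm1.1 _ _ _ mij mij').
Qed.

Lemma anchor_lower j l : m2 j l -> anchor (inr l) = middle r t j.
Proof.
move=> mjl /=; case: pickP => [j' mjl'|/(_ j)]; last by rewrite mjl.
by rewrite (hm2.2 _ _ _ mjl mjl').
Qed.

Lemma anchor_upper_inv i j : anchor (inl (inl i)) = middle r t j -> m1 i j.
Proof. by move=> /=; case: pickP => [j' h []<-|]. Qed.

Lemma anchor_lower_inv j l : anchor (inr l) = middle r t j -> m2 j l.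
Proof. by move=> /=; case: pickP => [j' h []<-|]. Qed.

(** Every element is linked to its anchor, and a link does not change the
    anchor. *)
Lemma linkedE x y : linked (diag m2) (diag m1) x y = (anchor x == anchor y).
Proof.
set G := glued (diag m2) (diag m1).
have GE u v : G u v = [exists a, [exists b, [&& u == upper t a, v == upper t b & joins m1 a b]]]
    || [exists a, [exists b, [&& u == lower r a, v == lower r b & joins m2 a b]]].
  congr (_ || _); apply/exists_inP/existsP.
  - case=> B BD /andP[/imsetP[a aB ->] /imsetP[b bB ->]].
    exists a; apply/existsP; exists b; rewrite !eqxx /= -same_part_diag //.
    by apply/exists_inP; exists B; rewrite ?aB.
  - case=> a /existsP[b /and3P[/eqP-> /eqP->]]; rewrite -same_part_diag //.
    by case/exists_inP=> B BD /andP[aB bB]; exists B; rewrite ?imset_f.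
  - case=> B BD /andP[/imsetP[a aB ->] /imsetP[b bB ->]].
    exists a; apply/existsP; exists b; rewrite !eqxx /= -same_part_diag //.
    by apply/exists_inP; exists B; rewrite ?aB.
  - case=> a /existsP[b /and3P[/eqP-> /eqP->]]; rewrite -same_part_diag //.
    by case/exists_inP=> B BD /andP[aB bB]; exists B; rewrite ?imset_f.
have G_sym : symmetric G.
  by move=> u v; congr (_ || _); apply: eq_existsb => B;
    rewrite [X in _ && X]andbC.
have G_anchor u v : G u v -> anchor u = anchor v.
  rewrite GE => /orP[] /existsP[a /existsP[b /and3P[/eqP-> /eqP->]]] /orP[/eqP->//|].
    by case: a b => [i|j] [i'|j'] // h; rewrite /upper (anchor_upper h).
  by case: a b => [i|j] [i'|j'] // h; rewrite /lower (anchor_lower h).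
have link_anchor u : linked (diag m2) (diag m1) u (anchor u).
  case: u => [[i|j]|l]; rewrite /linked -/G /=; try exact: connect0.
    case: pickP => [j mij|_]; last exact: connect0.
    apply: connect1; rewrite GE; apply/orP; left; apply/existsP; exists (inl i).
    by apply/existsP; exists (inr j); rewrite !eqxx.
  case: pickP => [j mjl|_]; last exact: connect0.
  apply: connect1; rewrite GE; apply/orP; right; apply/existsP; exists (inr l).
  by apply/existsP; exists (inl j); rewrite !eqxx.
apply/idP/eqP=> [/connectP[p]|e].
  by elim: p x => [|z p IH] x /= => [_ ->|/andP[/G_anchor-> /IH]].
apply: connect_trans (link_anchor x) _.
by rewrite -/G (sym_connect_sym G_sym) e; apply: link_anchor.
Qed.

Lemma anchor_middle j : anchor (middle r t j) = middle r t j.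
Proof. by []. Qed.

Lemma starE : star (diag m2) (diag m1) =
  [set [set y | anchor (outer s x) == anchor (outer s y)] | x : 'I_r + 'I_t].
Proof.
rewrite /star /equivalence_partition.
by apply/setP=> B; apply/imsetP/imsetP => -[x _ ->];
  exists x => //; apply/setP=> y; rewrite !inE linkedE.
Qed.

(** Both conditions on tau concern the relation of lying in one part: it
    contains the relation of the glued diagram, and it adds nothing to the
    components that reach the middle row. *)
Lemma contributesP (T : {set {set 'I_r + 'I_t}}) : partition T setT ->
  reflect ((forall x y, anchor (outer s x) = anchor (outer s y) -> same_part T x y)
    /\ (forall x y, anchored (outer s x) -> same_part T x y ->
          anchor (outer s x) = anchor (outer s y)))
  (contributes (diag m2) (diag m1) T).
Proof.
move=> pT; have refl x := same_partxx x pT.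
have tr := same_part_trans pT.
pose B x := [set y | anchor (outer s x) == anchor (outer s y)].
have BS x : B x \in [set B x | x : 'I_r + 'I_t] by apply: imset_f.
rewrite /contributes starE; apply: (iffP andP) => [[/forall_inP h1 /forall_inP h2]|[h1 h2]].
- split=> x y.
    move=> e; have /exists_inP[C CT /subsetP sub] := h1 _ (BS x).
    by apply/exists_inP; exists C => //; rewrite !sub // inE ?e.
  move=> /existsP[j jx] xy; have : B x \in T.
    apply: (implyP (h2 _ (BS x))).
    apply/exists_inP; exists x; first by rewrite inE.
    by apply/existsP; exists j; rewrite linkedE anchor_middle.
  rewrite (partition_same_part pT) => /imsetP[z _ eB].
  have: x \in B x by rewrite inE.
  rewrite eB inE => zx.
  have : y \in [set y | same_part T z y] by rewrite inE; apply: tr xy.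
  by rewrite -eB inE => /eqP.
- split; apply/forall_inP=> _ /imsetP[x _ ->].
    apply/exists_inP; exists [set y | same_part T x y].
      exact: part_in.
    by apply/subsetP=> y; rewrite !inE => /eqP/h1.
  apply/implyP=> /exists_inP[y]; rewrite inE => /eqP xy /existsP[j].
  rewrite linkedE anchor_middle => yj.
  have e : [set z | same_part T x z] = B x; last by rewrite -/(B x) -e; exact: part_in.
  apply/setP=> z; rewrite !inE; apply/idP/eqP; last exact: h1.
  by apply: h2; apply/existsP; exists j; rewrite xy.
Qed.


Lemma anchor_upperP i :
  (exists2 j, m1 i j & anchor (inl (inl i)) = middle r t j) \/
  (anchor (inl (inl i)) = inl (inl i)).
Proof. by rewrite /=; case: pickP => [j mij|_]; [left; exists j | right]. Qed.

Lemma anchor_lowerP l :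
  (exists2 j, m2 j l & anchor (inr l) = middle r t j) \/
  (anchor (inr l) = inr l).
Proof. by rewrite /=; case: pickP => [j mjl|_]; [left; exists j | right]. Qed.

(** In terms of partial injections: tau extends the composite of m1 and m2, and
    every additional pair joins a source element outside the domain of m1 to a
    target element outside the range of m2. *)
Lemma contributes_incidence (T : {set {set 'I_r + 'I_t}}) : is_pbar T ->
  reflect ((forall i j l, m1 i j -> m2 j l -> incidence T i l)
    /\ (forall i l, incidence T i l ->
          (exists j, m1 i j) \/ (exists j, m2 j l) ->
          exists j, m1 i j /\ m2 j l))
  (contributes (diag m2) (diag m1) T).
Proof.
move=> hT; have pT := pbar_partition hT.
apply: (iffP (contributesP pT)) => -[h1 h2]; split.
- move=> i j l mij mjl; apply: h1.
  by rewrite (anchor_upper mij) (anchor_lower mjl).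
- move=> i l il [[j mij]|[j mjl]]; exists j; split=> //.
    apply: (@anchor_lower_inv j); rewrite -(anchor_upper mij); symmetry.
    by apply: (h2 (inl i) (inr l)) => //; apply/existsP; exists j;
       rewrite /outer (anchor_upper mij).
  apply: (@anchor_upper_inv _ j); rewrite -(anchor_lower mjl); symmetry.
  apply: (h2 (inr l) (inl i)); last by rewrite same_part_sym.
  by apply/existsP; exists j; rewrite /outer (anchor_lower mjl).
- have K i l : anchor (inl (inl i)) = anchor (inr l) -> incidence T i l.
    case: (anchor_upperP i) (anchor_lowerP l) => [[j mij ->]|->] [[j' mjl ->]|->] //.
    by case=> jj'; apply: h1 mij _; rewrite jj'.
  case=> [i|l] [i'|l']; rewrite /outer => e.
  + rewrite (_ : i = i') ?same_partxx //; move: e.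
    case: (anchor_upperP i) (anchor_upperP i') => [[j m ->]|->] [[j' m' ->]|->] // [].
      by move=> jj'; apply: hm1.2 m _; rewrite jj'.
    by [].
  + exact: (K _ _ e).
  + by rewrite same_part_sym; apply: (K _ _ (esym e)).
  + rewrite (_ : l = l') ?same_partxx //; move: e.
    case: (anchor_lowerP l) (anchor_lowerP l') => [[j m ->]|->] [[j' m' ->]|->] // [].
      by move=> jj'; apply: hm2.1 m _; rewrite jj'.
    by [].
- move=> x y; rewrite same_part_incidence // => + /orP[/eqP->//|].
  case: x y => [i|l] [i'|l'] // /existsP[j]; rewrite /outer => /eqP e m.
    have [|j' [m' m'']] := h2 _ _ m; first by left; exists j; exact: anchor_upper_inv e.
    by rewrite (anchor_upper m') (anchor_lower m'').
  have [|j' [m' m'']] := h2 _ _ m; first by right; exists j; exact: anchor_lower_inv e.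
  by rewrite (anchor_upper m') (anchor_lower m'').
Qed.

(** A component inside the middle row is a single element, met by neither of
    the two diagrams. *)
Lemma nmidE : nmid (diag m2) (diag m1) =
  #|[set j | [forall i, ~~ m1 i j] && [forall l, ~~ m2 j l]]|.
Proof.
have mid_inj : injective (fun j : 'I_s => [set middle r t j]) by move=> j j' e; have [] := set1_inj e.
rewrite -(card_imset _ mid_inj) /nmid; apply: eq_card => B.
rewrite inE; apply/andP/imsetP.
- case=> /imsetP[x _ eB] /subsetP sub.
  have /sub/imsetP[j _ ex] : x \in B by rewrite eB !inE linkedE eqxx.
  exists j; last first.
    apply/setP=> y; rewrite !inE; apply/idP/eqP=> [yB|->].
      have /imsetP[j' _ ey] := sub _ yB.
      by move: yB; rewrite eB !inE linkedE ex ey !anchor_middle => /eqP->.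
    by rewrite eB !inE linkedE ex eqxx.
  have noB y : (forall j', y != middle r t j') -> anchor y != middle r t j.
    move=> ney; apply/eqP=> e; have /sub/imsetP[j' _ /eqP] : y \in B.
      by rewrite eB !inE linkedE ex e eqxx.
    exact/negP/ney.
  rewrite inE; apply/andP; split; apply/forallP=> a; apply/negP=> ma.
    by have := noB (inl (inl a)) (fun=> isT); rewrite (anchor_upper ma) eqxx.
  by have := noB (inr a) (fun=> isT); rewrite (anchor_lower ma) eqxx.
- case=> j; rewrite inE => /andP[/forallP n1 /forallP n2] ->.
  split; last by apply/subsetP=> y; rewrite inE => /eqP->; apply: imset_f.
  apply/imsetP; exists (middle r t j) => //; apply/setP=> y.
  rewrite !inE linkedE anchor_middle; apply/eqP/eqP=> [->//|e].
  case: y e => [[i|j']|l] e //; symmetry in e.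
    by have := n1 i; rewrite (anchor_upper_inv e).
  by have := n2 l; rewrite (anchor_lower_inv e).
Qed.

End Composition.

(** * Composition laws in the Deligne category *)

Section Insertion.
Variables (T : Type) (n : nat).

Definition insert (j : 'I_n.+1) (x : T) (f : {ffun 'I_n -> T}) : {ffun 'I_n.+1 -> T} :=
  [ffun a => if unlift j a is Some b then f b else x].

Definition delete (j : 'I_n.+1) (f : {ffun 'I_n.+1 -> T}) : {ffun 'I_n -> T} :=
  [ffun b => f (lift j b)].

Lemma insert_at j x f : insert j x f j = x.
Proof. by rewrite ffunE unlift_none. Qed.

Lemma insert_lift j x f b : insert j x f (lift j b) = f b.
Proof. by rewrite ffunE liftK. Qed.

Lemma insert_delete j (f : {ffun 'I_n.+1 -> T}) : insert j (f j) (delete j f) = f.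
Proof.
by apply/ffunP=> a; rewrite ffunE; case: unliftP => [b|] ->; rewrite ?ffunE.
Qed.

Lemma delete_insert j x f : delete j (insert j x f) = f.
Proof. by apply/ffunP=> b; rewrite ffunE insert_lift. Qed.

End Insertion.

Section DiagramCategory.
Variables (K : numFieldType) (nu : K).

Lemma dcomp_basis r s t (D2 : {set {set 'I_s + 'I_t}}) (D1 : {set {set 'I_r + 'I_s}}) :
  is_pbar D2 -> is_pbar D1 ->
  dcomp nu (dbasis K D2) (dbasis K D1) = [ffun T => dcoef nu D2 D1 (val T)].
Proof.
move=> h2 h1; apply/ffunP=> T; rewrite !ffunE.
pose P2 : pbar s t := exist _ D2 h2; pose P1 : pbar r s := exist _ D1 h1.
rewrite (bigD1 P2) //= [X in _ + X]big1.
  rewrite addr0 (bigD1 P1) //= big1.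
    by rewrite !ffunE /= !eqxx !mul1r addr0.
  move=> P; rewrite -val_eqE /= => /negbTE neP.
  by rewrite !ffunE /= neP mulr0 mul0r.
move=> P; rewrite -val_eqE /= => /negbTE neP.
by rewrite big1 // => Q _; rewrite !ffunE /= neP !mul0r.
Qed.

Lemma eq_diagP r s (m : 'I_r -> 'I_s -> bool) (T : {set {set 'I_r + 'I_s}}) :
  part_inj m -> is_pbar T ->
  reflect (incidence T =2 m) (T == diag m).
Proof.
move=> hm hT; apply: (iffP eqP) => [-> i j|e]; first by rewrite incidence_diag.
by rewrite -(diag_incidence hT); apply: eq_diag.
Qed.

(** When all source elements, or all target elements, reach the middle row,
    nothing can be merged and the composite is a multiple of one diagram. *)
Lemma dcomp_diag_glue r s t (m2 : 'I_s -> 'I_t -> bool) (m1 : 'I_r -> 'I_s -> bool)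
    (m : 'I_r -> 'I_t -> bool) n :
  part_inj m2 -> part_inj m1 -> part_inj m ->
  #|[set j | [forall i, ~~ m1 i j] && [forall l, ~~ m2 j l]]| = n ->
  (forall i l, reflect (exists j, m1 i j /\ m2 j l) (m i l)) ->
  (forall i, exists j, m1 i j) \/ (forall l, exists j, m2 j l) ->
  dcomp nu (dbasis K (diag m2)) (dbasis K (diag m1)) =
  (\prod_(j < n) (nu - #|diag m|%:R - j%:R)) *: dbasis K (diag m).
Proof.
move=> hm2 hm1 hm <- mP tot; rewrite dcomp_basis; try exact: part_inj_pbar.
apply/ffunP=> -[T hT]; rewrite !ffunE /dcoef /= nmidE //.
suff -> : contributes (diag m2) (diag m1) T = (T == diag m).
  by case: eqP => [->|_]; rewrite /GRing.scale /= ?mulr1 ?mulr0.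
apply/contributes_incidence/eqP => // [[h1 h2]|->].
  rewrite -(diag_incidence hT); apply: eq_diag => i l; apply/idP/mP.
    by move/h2; apply; case: tot => h; [left|right].
  by case=> j [a b]; apply: h1 a b.
by split=> [i j l a b|i l]; rewrite incidence_diag //; [apply/mP; exists j|move/mP].
Qed.


Lemma eq_dres k l (f g : 'I_l -> 'I_k) : f =1 g -> dres K f = dres K g.
Proof. by move=> e; congr dbasis; apply: eq_diag => i j; rewrite e. Qed.

Lemma dres_part_inj k l (f : 'I_l -> 'I_k) : injective f ->
  part_inj (fun i j => i == f j).
Proof.
by move=> fI; split=> [i j j' /eqP-> /eqP/fI|i i' j /eqP-> /eqP->].
Qed.

Lemma dres_star_part_inj k (m : 'I_k.+1) : part_inj (fun i j => lift m i == j).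
Proof.
by split=> [i j j' /eqP<- /eqP|i i' j /eqP<- /eqP/lift_inj].
Qed.

(** The composition is contravariant because f : 'I_l -> 'I_k indexes a
    morphism from Delta_k to Delta_l. *)
Lemma dcomp_dres r s t (f : 'I_t -> 'I_s) (g : 'I_s -> 'I_r) :
  injective f -> injective g ->
  dcomp nu (dres K f) (dres K g) = dres K (g \o f).
Proof.
move=> fI gI; rewrite (@dcomp_diag_glue _ _ _ _ _ (fun i l => i == g (f l)) 0%N).
- by rewrite big_ord0 scale1r.
- exact: dres_part_inj.
- exact: dres_part_inj.
- by apply: dres_part_inj; apply: inj_comp.
- apply/eqP; rewrite cards_eq0; apply/eqP/setP=> j; rewrite !inE; apply/negbTE.
  by rewrite negb_and; apply/orP; left; apply/forallPn; exists (g j); rewrite eqxx.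
- move=> i l; apply: (iffP eqP) => [->|[j [/eqP-> /eqP->]]] //.
  by exists (f l).
- by right=> l; exists (f l).
Qed.

(** The diagram of f in which the target element j, absent from the domain of f,
    stays alone; it occurs on both sides of the intertwining relation and
    cancels. *)
Definition dgap k l (j : 'I_l.+1) (f : 'I_l -> 'I_k) : dhom K k l.+1 :=
  dbasis K (diag (fun i b => if unlift j b is Some a then i == f a else false)).

Lemma dgap_part_inj k l (j : 'I_l.+1) (f : 'I_l -> 'I_k) : injective f ->
  part_inj (fun i b => if unlift j b is Some a then i == f a else false).
Proof.
move=> fI; split=> [i b b'|i i' b].
  case: unliftP => [a|] -> //; case: unliftP => [a'|] -> // /eqP-> /eqP/fI.
  by move->.
by case: unliftP => [a|] // _ /eqP-> /eqP->.
Qed.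

Lemma card_diag_total k l (f : 'I_l -> 'I_k) : injective f ->
  #|diag (fun i j => i == f j)| = k.
Proof.
move=> fI; pose D := diag (fun i j => i == f j).
have hm := dres_part_inj fI.
have pD : partition D setT by apply/pbar_partition/part_inj_pbar.
rewrite -/D (partition_same_part pD).
transitivity #|[set [set y | same_part D (inl i) y] | i : 'I_k]|.
  apply: eq_card => B; apply/imsetP/imsetP=> -[x _ ->]; last by exists (inl x).
  case: x => [i|j]; first by exists i.
  exists (f j) => //; apply/setP=> y; rewrite !inE.
  have e : same_part D (inl (f j)) (inr j) by rewrite same_part_diag // /joins eqxx.
  have tr := same_part_trans pD; apply/idP/idP; apply: tr => //.
  by rewrite same_part_sym.
rewrite card_imset ?card_ord // => i i' e.
have : inl i' \in [set y | same_part D (inl i) y] by rewrite e inE same_partxx.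
by rewrite inE same_part_diag // /joins orbF => /eqP[].
Qed.

(** The middle element m is alone, so it is a component of the middle row; the
    remaining diagram has k parts, since every target element is joined to one
    of the k source elements. *)
Lemma dcomp_dres_star_skip k l (m : 'I_k.+1) (f : 'I_l -> 'I_k) : injective f ->
  dcomp nu (dres K (lift m \o f)) (dres_star K m) = (nu - k%:R) *: dres K f.
Proof.
move=> fI; rewrite (@dcomp_diag_glue _ _ _ _ _ (fun i l => i == f l) 1%N).
- by rewrite card_diag_total // big_ord1 subr0.
- exact/dres_part_inj/(inj_comp (@lift_inj _ m)).
- exact: dres_star_part_inj.
- exact: dres_part_inj.
- rewrite (_ : [set j | _] = [set m]) ?cards1 //; apply/setP=> j; rewrite !inE.
  apply/andP/eqP=> [[/forallP h _]|->].
    by case: (unliftP m j) => // i e; have := h i; rewrite e eqxx.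
  split; apply/forallP=> i; first by rewrite eq_sym neq_lift.
  by rewrite neq_lift.
- move=> i b; apply: (iffP eqP) => [->|[j [/eqP<- /eqP/lift_inj]]] //.
  by exists (lift m (f b)).
- by left=> i; exists (lift m i).
Qed.

(** The middle element m, isolated in res*_m, is joined to the target
    element j, which is therefore isolated in the composite. *)
Lemma dcomp_dres_star_hit k l (m : 'I_k.+1) (j : 'I_l.+1) (f : {ffun 'I_l -> 'I_k}) :
  injective f ->
  dcomp nu (dres K (insert j m [ffun a => lift m (f a)])) (dres_star K m) = dgap j f.
Proof.
move=> fI; set g := insert _ _ _.
have gI : injective g.
  move=> a b; rewrite /g !ffunE; case: unliftP => [a'|] ->; case: unliftP => [b'|] -> //.
  - by rewrite !ffunE => /lift_inj/fI->.
  - by rewrite ffunE => /eqP; rewrite eq_sym (negbTE (neq_lift _ _)).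
  - by rewrite ffunE => /eqP; rewrite (negbTE (neq_lift _ _)).
rewrite (@dcomp_diag_glue _ _ _ _ _
  (fun i b => if unlift j b is Some a then i == f a else false) 0%N).
- by rewrite big_ord0 scale1r.
- exact: dres_part_inj.
- exact: dres_star_part_inj.
- exact: dgap_part_inj.
- apply/eqP; rewrite cards_eq0; apply/eqP/setP=> b; rewrite !inE; apply/negbTE.
  rewrite negb_and; case: (unliftP m b) => [i|] ->.
    by apply/orP; left; apply/forallPn; exists i; rewrite eqxx.
  by apply/orP; right; apply/forallPn; exists j; rewrite insert_at eqxx.
- move=> i b; rewrite /g ffunE; case: unliftP => [a|] _.
    rewrite ffunE; apply: (iffP eqP) => [->|[c [/eqP<- /eqP/lift_inj]]] //.
    by exists (lift m (f a)).
  apply: ReflectF => -[c [/eqP<-]]; rewrite eq_sym; exact/negP/neq_lift.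
- by left=> i; exists (lift m i).
Qed.

(** The only composite of the proof in which parts are merged: the isolated
    target element j can be joined to any source element that f leaves out. *)
Lemma dcomp_star_dres k l (j : 'I_l.+1) (f : {ffun 'I_l -> 'I_k}) : injective f ->
  dcomp nu (dres_star K j) (dres K f) =
    dgap j f + \sum_(i | i \notin codom f) dres K (insert j i f).
Proof.
move=> fI; have h1 := dres_part_inj fI; have h2 := dres_star_part_inj j.
have insI i : i \notin codom f -> injective (insert j i f).
  move=> ni a b; rewrite !ffunE; case: unliftP => [a'|] ->; case: unliftP => [b'|] -> //.
  - by move/fI->.
  - by move=> e; rewrite -e codom_f in ni.
  - by move=> e; rewrite e codom_f in ni.
rewrite dcomp_basis; try exact: part_inj_pbar.
apply/ffunP=> -[T hT]; rewrite !ffunE /dcoef /= sum_ffunE.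
have -> : nmid (diag (fun i b => lift j i == b)) (diag (fun i b => i == f b)) = 0%N.
  rewrite nmidE //; apply/eqP; rewrite cards_eq0; apply/eqP/setP=> b; rewrite !inE; apply/negbTE.
  by rewrite negb_and; apply/orP; left; apply/forallPn; exists (f b); rewrite eqxx.
rewrite big_ord0; have hg := dgap_part_inj j fI.
have hI := incidence_part_inj hT.
have -> : contributes (diag (fun i b => lift j i == b)) (diag (fun i b => i == f b)) T =
    (T == diag (fun i b => if unlift j b is Some a then i == f a else false)) ||
    [exists i, (i \notin codom f) && (T == diag (fun i' b => i' == insert j i f b))].
  apply/contributes_incidence/idP => // [[H1 H2]|/orP[|/existsP[i /andP[ni]]]].
  - have row b a i : b = lift j a -> incidence T i b = (i == f a).
      move=> ->; apply/idP/eqP=> [h|->]; last by apply: (H1 _ a).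
      by have [|a' [/eqP-> /eqP/lift_inj->]] := H2 _ _ h; first by right; exists a.
    (* Whether j is isolated in T decides between the two kinds of terms. *)
    case: (pickP (incidence T ^~ j)) => [i ij|none].
      have ni : i \notin codom f.
        apply/codomP=> -[a e]; have [|a' [_ /eqP/esym/eqP]] := H2 _ _ ij.
          by left; exists a; apply/eqP.
        by rewrite (negbTE (neq_lift _ _)).
      apply/orP; right; apply/existsP; exists i; rewrite ni /=.
      apply/eq_diagP => // [|i' b]; first exact/dres_part_inj/insI.
      rewrite ffunE; case: unliftP => [a|] e; first exact: row.
      rewrite e; apply/idP/eqP=> [h|->//].
      exact: hI.2 h ij.
    apply/orP; left; apply/eq_diagP => // i' b; case: unliftP => [a|] e.
      exact: row.
    by rewrite e none.
  - move/(eq_diagP hg hT)=> e; split=> [i a b /eqP-> /eqP<-|i b].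
      by rewrite e liftK.
    by rewrite e; case: unliftP => [a|] // -> /eqP->; exists a; rewrite !eqxx.
  - move/(eq_diagP (dres_part_inj (insI _ ni)) hT)=> e; split=> [i' a b /eqP-> /eqP<-|i' b].
      by rewrite e insert_lift.
    rewrite e ffunE; case: unliftP => [a|] -> /eqP->; first by exists a; rewrite !eqxx.
    case=> -[a]; first by move=> /eqP ei; rewrite ei codom_f in ni.
    by rewrite eq_sym (negbTE (neq_lift _ _)).
under eq_bigr => i _ do rewrite ffunE /=.
have [i0 /andP[ni0 /eqP e0]|none] := pickP (fun i => (i \notin codom f) && (T == diag (fun i' b => i' == insert j i f b))).
  have neD : (T == diag (fun i b => if unlift j b is Some a then i == f a else false)) = false.
    apply/(eq_diagP hg hT)=> /(_ i0 j); rewrite unlift_none e0 incidence_diag ?insert_at ?eqxx //.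
    exact/dres_part_inj/insI.
  rewrite neD (bigD1 i0) //= big1 => [|i /andP[ni ne]].
    by rewrite -e0 eqxx addr0 add0r; case: existsP => // -[]; exists i0; rewrite ni0 -e0 eqxx.
  case: eqP => // /eqP/(eq_diagP (dres_part_inj (insI _ ni)) hT)/(_ i0 j).
  rewrite insert_at e0 incidence_diag ?insert_at ?eqxx; last exact/dres_part_inj/insI.
  by move/esym/eqP=> ei; rewrite ei eqxx in ne.
have -> : [exists i, (i \notin codom f) && (T == diag (fun i' b => i' == insert j i f b))] = false.
  by apply/existsP => -[a]; rewrite none.
rewrite orbF.
rewrite big1 ?addr0; first by case: eqP.
by move=> i ni; have := none i; rewrite ni /= => ->.
Qed.

End DiagramCategory.

(** * Sums over injections *)

Section Reindexing.
Variables (V : Type) (idx : V) (op : Monoid.com_law idx).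

Lemma big_reindex (I J : finType) (P : pred I) (Q : pred J)
    (h : J -> I) (F : I -> V) :
  (forall j, Q j -> P (h j)) -> {in Q &, injective h} ->
  (forall i, P i -> exists2 j, Q j & h j = i) ->
  \big[op/idx]_(i | P i) F i = \big[op/idx]_(j | Q j) F (h j).
Proof.
move=> hP hI hS; rewrite -(big_imset F hI); apply: eq_bigl => i.
apply/idP/imsetP=> [/hS[j Qj <-]|[j Qj ->]]; last exact: hP.
by exists j.
Qed.

Lemma big_codom (I J : finType) (f : J -> I) (P : pred I) (F : I -> V) :
  injective f ->
  \big[op/idx]_(i | (i \in codom f) && P i) F i = \big[op/idx]_(j | P (f j)) F (f j).
Proof.
move=> fI; apply: big_reindex => [j Pj|j j' _ _ /fI//|i /andP[/codomP[j ->] Pj]].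
  by rewrite codom_f.
by exists j.
Qed.

Lemma big_codomC (I J : finType) (f : J -> I) (F : I -> V) :
  injective f ->
  \big[op/idx]_i F i = op (\big[op/idx]_j F (f j)) (\big[op/idx]_(i | i \notin codom f) F i).
Proof.
move=> fI; rewrite (bigID (mem (codom f))) /= -(big_codom xpredT F fI).
by congr (op _ _); apply: eq_bigl => i; rewrite andbT.
Qed.

End Reindexing.
Arguments big_reindex [V idx op I J P Q h] F.
Arguments big_codom [V idx op I J f] P F.
Arguments big_codomC [V idx op I J f] F.

Section Injections.
Variable V : nmodType.

(** Parametrizes the maps into k + 1 points that avoid m. *)
Definition skip k l (m : 'I_k.+1) (f : {ffun 'I_l -> 'I_k}) : {ffun 'I_l -> 'I_k.+1} :=
  [ffun a => lift m (f a)].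

Lemma skip_inj k l (m : 'I_k.+1) : injective (@skip k l m).
Proof.
by move=> f g /ffunP e; apply/ffunP=> a; have := e a; rewrite !ffunE => /lift_inj.
Qed.

Lemma injective_skip k l (m : 'I_k.+1) (f : {ffun 'I_l -> 'I_k}) :
  injective (skip m f) <-> injective f.
Proof.
split=> fI a b; last by rewrite !ffunE => /lift_inj/fI.
by move=> e; apply: fI; rewrite !ffunE e.
Qed.

Lemma skip_codom k l (m : 'I_k.+1) (f : {ffun 'I_l -> 'I_k}) i :
  (lift m i \in codom (skip m f)) = (i \in codom f).
Proof.
apply/codomP/codomP=> -[a e]; exists a; last by rewrite ffunE e.
by move: e; rewrite ffunE => /lift_inj.
Qed.

Lemma skip_notin k l (m : 'I_k.+1) (f : {ffun 'I_l -> 'I_k}) :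
  m \notin codom (skip m f).
Proof.
by apply/codomP=> -[a]; rewrite ffunE => /eqP; rewrite (negbTE (neq_lift _ _)).
Qed.

Lemma skip_onto k l (m : 'I_k.+1) (f : {ffun 'I_l -> 'I_k.+1}) :
  m \notin codom f -> exists g, skip m g = f.
Proof.
move=> nm; have /fin_all_exists[g gP] a : exists b, f a = lift m b.
  case: (unliftP m (f a)) => [b ->|e]; first by exists b.
  by rewrite -e codom_f in nm.
by exists [ffun a => g a]; apply/ffunP=> a; rewrite !ffunE gP.
Qed.

Lemma injective_insert k l (j : 'I_l.+1) (m : 'I_k) (f : {ffun 'I_l -> 'I_k}) :
  injective (insert j m f) <-> injective f /\ m \notin codom f.
Proof.
split=> [gI|[fI nm] a b].
  split=> [a b e|].
    by apply: (@lift_inj _ j); apply: gI; rewrite !insert_lift.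
  apply/codomP=> -[a e]; have := gI j (lift j a).
  rewrite insert_at insert_lift => /(_ e)/eqP.
  by rewrite (negbTE (neq_lift _ _)).
rewrite !ffunE; case: (unliftP j a) => [a'|] ->; case: (unliftP j b) => [b'|] -> //.
- by move/fI->.
- by move=> e; rewrite -e codom_f in nm.
- by move=> e; rewrite e codom_f in nm.
Qed.

Lemma sum_inj_avoid k l (m : 'I_k.+1) (F : {ffun 'I_l -> 'I_k.+1} -> V) :
  \sum_(f : {ffun 'I_l -> 'I_k.+1} | injectiveb f && (m \notin codom f)) F f =
  \sum_(f : {ffun 'I_l -> 'I_k} | injectiveb f) F (skip m f).
Proof.
apply: big_reindex => [f /injectiveP fI|f g _ _|f /andP[/injectiveP fI /skip_onto[g e]]].
- by rewrite skip_notin andbT; apply/injectiveP/injective_skip.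
- exact: skip_inj.
- by exists g => //; apply/injectiveP/(@injective_skip _ _ m); rewrite e.
Qed.

Lemma sum_inj_insert k l (j : 'I_l.+1) (F : {ffun 'I_l.+1 -> 'I_k} -> V) :
  \sum_(f : {ffun 'I_l.+1 -> 'I_k} | injectiveb f) F f =
  \sum_(f : {ffun 'I_l -> 'I_k} | injectiveb f)
    \sum_(m | m \notin codom f) F (insert j m f).
Proof.
rewrite pair_big_dep /=.
apply: (big_reindex (h := fun u : {ffun 'I_l -> 'I_k} * 'I_k => insert j u.2 u.1)).
- by case=> f m /= /andP[/injectiveP fI nm]; apply/injectiveP/injective_insert.
- case=> f m [g n] _ _ /= e; congr (_, _).
    by rewrite -(delete_insert j m f) e delete_insert.
  by rewrite -(insert_at j m f) e insert_at.
- move=> f /injectiveP fI; exists (delete j f, f j); last exact: insert_delete.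
  move: fI; rewrite -{1}(insert_delete j f) => /injective_insert[gI nj].
  by apply/andP; split=> //; apply/injectiveP.
Qed.

Lemma sum_inj_hit k l (j : 'I_l.+1) (m : 'I_k.+1) (F : {ffun 'I_l.+1 -> 'I_k.+1} -> V) :
  \sum_(f : {ffun 'I_l.+1 -> 'I_k.+1} | injectiveb f && (f j == m)) F f =
  \sum_(f : {ffun 'I_l -> 'I_k} | injectiveb f) F (insert j m (skip m f)).
Proof.
rewrite -(sum_inj_avoid m (fun f => F (insert j m f))).
apply: big_reindex.
- move=> f /andP[/injectiveP fI nm]; rewrite insert_at eqxx andbT.
  exact/injectiveP/injective_insert.
- by move=> f g _ _ e; rewrite -(delete_insert j m f) e delete_insert.
- move=> f /andP[/injectiveP fI /eqP fj]; exists (delete j f); last first.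
    by rewrite -{1}fj insert_delete.
  move: fI; rewrite -{1}(insert_delete j f) fj => /injective_insert[gI nj].
  by apply/andP; split=> //; apply/injectiveP.
Qed.

(** Used to organize pairs of composable injections by their composite and the
    image of the outer map. *)
Lemma sum_inj_factor k l m (f : {ffun 'I_l -> 'I_k}) (F : {ffun 'I_m -> 'I_k} -> V) :
  injective f ->
  \sum_(g : {ffun 'I_m -> 'I_l} | injectiveb g) F [ffun a => f (g a)] =
  \sum_(h : {ffun 'I_m -> 'I_k} | injectiveb h && [forall a, h a \in codom f]) F h.
Proof.
move=> fI; symmetry; apply: big_reindex.
- move=> g /injectiveP gI; apply/andP; split; last first.
    by apply/forallP=> a; rewrite ffunE codom_f.
  by apply/injectiveP=> a b; rewrite !ffunE => /fI/gI.
- move=> g g' _ _ /ffunP e; apply/ffunP=> a; apply: fI.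
  by have := e a; rewrite !ffunE.
- move=> h /andP[/injectiveP hI /forallP hf].
  exists [ffun a => iinv (hf a)].
    apply/injectiveP=> a b; rewrite !ffunE => ab; apply: hI.
    by rewrite -(f_iinv (hf a)) -(f_iinv (hf b)) ab.
  by apply/ffunP=> a; rewrite !ffunE f_iinv.
Qed.

Lemma sum_inj_image k l (F : {set 'I_k} -> V) :
  \sum_(f : {ffun 'I_l -> 'I_k} | injectiveb f) F [set i in codom f] =
  \sum_(S : {set 'I_k} | #|S| == l) F S *+ l`!.
Proof.
rewrite (partition_big (fun f : {ffun 'I_l -> 'I_k} => [set i in codom f])
  (fun S : {set 'I_k} => #|S| == l)) /=; last first.
  by move=> f /injectiveP fI; rewrite cardsE card_codom // card_ord.
apply: eq_bigr => S /eqP cS.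
rewrite (eq_bigr (fun _ => F S)); last by move=> f /andP[_ /eqP->].
rewrite sumr_const; congr (_ *+ _).
transitivity #|[set f : {ffun 'I_l -> 'I_k} in ffun_on (mem S) | injectiveb f]|.
  apply: eq_card => f; rewrite !inE [LHS]andbC; apply: andb_id2r => /injectiveP fI.
  apply/eqP/ffun_onP=> [<- a|fS]; first by rewrite inE codom_f.
  apply/eqP; rewrite eqEcard; apply/andP; split.
    by apply/subsetP=> i; rewrite inE => /codomP[a ->]; apply: fS.
  by rewrite cS cardsE card_codom // card_ord.
by rewrite card_inj_ffuns_on card_ord cS ffactnn.
Qed.

End Injections.

(** The permutation is built by transpositions, correcting one value at a time;
    values already corrected are not touched because f and g are injective. *)
Lemma extend_injections k l (f g : 'I_l -> 'I_k) : injective f -> injective g ->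
  exists s : 'S_k, forall i, s (f i) = g i.
Proof.
move=> fI gI; suff /(_ l (leqnn l))[s sP] : forall n, (n <= l)%N ->
    exists s : 'S_k, forall i : 'I_l, (i < n)%N -> s (f i) = g i.
  by exists s => i; apply: sP.
elim=> [|n IH] le_nl; first by exists 1%g.
have [s sP] := IH (ltnW le_nl); pose m := Ordinal le_nl.
exists (s * tperm (s (f m)) (g m))%g => i; rewrite permM ltnS leq_eqVlt => /orP[/eqP e|lt_in].
  by rewrite (_ : i = m) ?tpermL //; apply: val_inj.
rewrite (sP i lt_in); apply: tpermD.
  by rewrite -(sP _ lt_in); apply/eqP=> /perm_inj/fI e; rewrite -e ltnn in lt_in.
by apply/eqP=> /gI e; rewrite -e ltnn in lt_in.
Qed.

Lemma incr_injective k l (f : {ffun 'I_l -> 'I_k}) : incr f -> injective f.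
Proof.
move=> /forallP inc i j e; apply/val_inj/eqP; rewrite eqn_leq.
have lt (a b : 'I_l) : (a < b)%N -> (f a < f b)%N by move/forallP: (inc a) => /(_ b)/implyP.
by apply/andP; split; rewrite leqNgt; apply/negP=> /lt; rewrite e ltnn.
Qed.

(** An increasing map is a strictly sorted tuple, hence a subset. *)
Lemma card_incr k l : #|[set f : {ffun 'I_l -> 'I_k} | incr f]| = 'C(k, l).
Proof.
rewrite -card_ltn_sorted_tuples.
pose h (f : {ffun 'I_l -> 'I_k}) : l.-tuple 'I_k := [tuple f i | i < l].
have hI : injective h.
  move=> f g e; apply/ffunP=> i; have := congr1 (fun t => tnth t i) e.
  by rewrite !tnth_mktuple.
rewrite -(card_imset _ hI); apply: eq_card => t; rewrite inE.
have nthE (u : l.-tuple 'I_k) (i : 'I_l) : nth 0%N (map val u) i = tnth u i.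
  by rewrite (nth_map (tnth u i)) ?size_tuple //; congr (val _); rewrite -tnth_nth.
apply/imsetP/idP=> [[f]|srt].
  rewrite inE => /forallP inc ->; apply/(sortedP 0%N) => i.
  rewrite size_map size_tuple => lt_il.
  have := nthE (h f) (Ordinal lt_il); have := nthE (h f) (Ordinal (ltnW lt_il)).
  rewrite /= => -> ->; rewrite !tnth_mktuple.
  by have /forallP/(_ (Ordinal lt_il))/implyP := inc (Ordinal (ltnW lt_il)); apply => /=.
exists [ffun i => tnth t i]; last first.
  by apply: eq_from_tnth => i; rewrite tnth_mktuple ffunE.
rewrite inE; apply/forallP=> i; apply/forallP=> j; apply/implyP=> lt_ij.
rewrite !ffunE -!nthE; apply: (sorted_ltn_nth ltn_trans) => //;
  by rewrite inE size_map size_tuple.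
Qed.

(** The sum over s depends only on the fact that f is injective, since two
    injections differ by a permutation of the target.  So the sum over the
    binomial(k, l) increasing maps and the sum over the binomial(k, l) l!
    injections are proportional, and in the latter each injection is hit k!
    times. *)
Lemma sum_incr_perm (V : nmodType) k l (F : {ffun 'I_l -> 'I_k} -> V) :
  (\sum_(f : {ffun 'I_l -> 'I_k} | incr f) \sum_(s : 'S_k) F [ffun i => s (f i)]) *+ l`! =
  (\sum_(f : {ffun 'I_l -> 'I_k} | injectiveb f) F f) *+ k`!.
Proof.
pose G (f : {ffun 'I_l -> 'I_k}) := \sum_(s : 'S_k) F [ffun i => s (f i)].
have GE (f g : {ffun 'I_l -> 'I_k}) : injective f -> injective g -> G f = G g.
  move=> fI gI; have [t tP] := extend_injections fI gI.
  rewrite /G (reindex_inj (mulgI t)); apply: eq_bigr => s _; congr F.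
  by apply/ffunP=> i; rewrite !ffunE permM tP.
have sumG : \sum_(f : {ffun 'I_l -> 'I_k} | injectiveb f) G f =
    (\sum_(f : {ffun 'I_l -> 'I_k} | injectiveb f) F f) *+ k`!.
  rewrite exchange_big -card_Sn -sumr_const; apply: eq_bigr => s _ /=.
  symmetry; apply: (big_reindex (h := fun f : {ffun 'I_l -> 'I_k} => [ffun i => s (f i)])).
  - move=> f /injectiveP fI; apply/injectiveP=> a b.
    by rewrite !ffunE => /perm_inj/fI.
  - move=> f g _ _ /ffunP e; apply/ffunP=> a; have := e a.
    by rewrite !ffunE => /perm_inj.
  - move=> f /injectiveP fI; exists [ffun i => s^-1%g (f i)].
      by apply/injectiveP=> a b; rewrite !ffunE => /perm_inj/fI.
    by apply/ffunP=> a; rewrite !ffunE permKV.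
rewrite -sumG.
have [f0 /injectiveP f0I|none] := pickP (fun f : {ffun 'I_l -> 'I_k} => injectiveb f).
  rewrite (eq_bigr (fun _ => G f0)) => [|f /incr_injective fI]; last exact: GE.
  rewrite [RHS](eq_bigr (fun _ => G f0)) => [|f /injectiveP fI]; last exact: GE.
  rewrite !sumr_const -mulrnA; congr (_ *+ _).
  transitivity ('C(k, l) * l`!)%N; first by rewrite -card_incr cardsE.
  by rewrite bin_ffact -[k in LHS]card_ord -[l in LHS]card_ord -card_inj_ffuns cardsE.
rewrite !big_pred0 ?mul0rn // => f; apply/negbTE/negP=> /incr_injective/injectiveP.
by rewrite none.
Qed.

(** * The canonical morphism as a sum over all injections *)

Section TensorCoefficient.
Variables (K : numFieldType) (nu : K) (d d' : nat).
Variables (p : 'I_d' -> 'I_d -> K) (c : 'I_d -> K).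

(** The matrix entry from the word w to the word w' of p applied in the
    positions of the image of f and c applied in the other positions. *)
Definition tcoef k l (f : {ffun 'I_l -> 'I_k}) (w : {ffun 'I_k -> 'I_d})
    (w' : {ffun 'I_l -> 'I_d'}) : K :=
  (\prod_i p (w' i) (w (f i))) * (\prod_(j | j \notin codom f) c (w j)).

(** The entry tcoef without the factor c at a position m outside the image of
    f: the slot in which a form or an endomorphism of U acts before c. *)
Definition tcoef_off k l (f : {ffun 'I_l -> 'I_k}) (m : 'I_k) (w : {ffun 'I_k -> 'I_d})
    (w' : {ffun 'I_l -> 'I_d'}) : K :=
  (\prod_i p (w' i) (w (f i))) * (\prod_(j | (j \notin codom f) && (j != m)) c (w j)).

(** The entry tcoef without the factor p at the target position a. *)
Definition tcoef_on k l (f : {ffun 'I_l -> 'I_k}) (a : 'I_l) (w : {ffun 'I_k -> 'I_d})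
    (w' : {ffun 'I_l -> 'I_d'}) : K :=
  (\prod_(i | i != a) p (w' i) (w (f i))) * (\prod_(j | j \notin codom f) c (w j)).

(** The sum over all injections that replaces the sum over increasing ones:
    unlike the latter it is defined, and has its good properties, before any
    symmetrization. *)
Definition canon_inj k l : ahom K (tens d k) (tens d' l) :=
  @AHom K (tens d k) (tens d' l) (fun w w' =>
    (l`!%:R)^-1 *: \sum_(f : {ffun 'I_l -> 'I_k} | injectiveb f) tcoef f w w' *: dres K f).

Definition update T n (i : 'I_n) (b : T) (w : {ffun 'I_n -> T}) : {ffun 'I_n -> T} :=
  [ffun j => if j == i then b else w j].

Lemma tcoef_offE k l (f : {ffun 'I_l -> 'I_k}) m w w' : m \notin codom f ->
  tcoef f w w' = c (w m) * tcoef_off f m w w'.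
Proof. by move=> nm; rewrite /tcoef (bigD1 m) //= mulrCA. Qed.

Lemma tcoef_onE k l (f : {ffun 'I_l -> 'I_k}) a w w' :
  tcoef f w w' = p (w' a) (w (f a)) * tcoef_on f a w w'.
Proof. by rewrite /tcoef (bigD1 a) //= mulrA. Qed.

Lemma tcoef_off_update k l (f : {ffun 'I_l -> 'I_k}) m b w w' : m \notin codom f ->
  tcoef_off f m (update m b w) w' = tcoef_off f m w w'.
Proof.
move=> nm; congr (_ * _); apply: eq_bigr => i; last first.
  by case/andP=> _ /negbTE e; rewrite ffunE e.
by move=> _; rewrite ffunE; case: eqP => // e; rewrite -e codom_f in nm.
Qed.

Lemma tcoef_on_update k l (f : {ffun 'I_l -> 'I_k}) a b w w' : injective f ->
  tcoef_on f a (update (f a) b w) w' = tcoef_on f a w w'.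
Proof.
move=> fI; congr (_ * _); apply: eq_bigr => i ni; rewrite ffunE.
  by rewrite (inj_eq fI) (negbTE ni).
by case: eqP => // e; rewrite e codom_f in ni.
Qed.

Lemma tcoef_on_update_target k l (f : {ffun 'I_l -> 'I_k}) a b w w' :
  tcoef_on f a w (update a b w') = tcoef_on f a w w'.
Proof. by congr (_ * _); apply: eq_bigr => i /negbTE ni; rewrite ffunE ni. Qed.

Lemma tcoef_off_skip k l (f : {ffun 'I_l -> 'I_k}) m w w' :
  tcoef_off (skip m f) m w w' = tcoef f (delete m w) w'.
Proof.
congr (_ * _); first by apply: eq_bigr => i _; rewrite !ffunE.
rewrite big_mkcond (bigD1_ord m) //= eqxx andbF mul1r [RHS]big_mkcond.
by apply: eq_bigr => j _; rewrite skip_codom eq_sym neq_lift andbT ffunE.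
Qed.

Lemma tcoef_on_insert k l (f : {ffun 'I_l -> 'I_k}) j m w w' :
  tcoef_on (insert j m f) j w w' = tcoef_off f m w (delete j w').
Proof.
congr (_ * _).
  rewrite big_mkcond (bigD1_ord j) //= eqxx mul1r; apply: eq_bigr => i _.
  by rewrite eq_sym neq_lift insert_lift ffunE.
apply: eq_bigl => i; rewrite -negb_or; congr (~~ _).
apply/codomP/orP=> [[a ->]|[/codomP[a ->]|/eqP->]].
- by case: (unliftP j a) => [b|] ->; rewrite ?insert_lift ?insert_at ?codom_f ?eqxx; [left|right].
- by exists (lift j a); rewrite insert_lift.
- by exists j; rewrite insert_at.
Qed.

Lemma tcoef_insert k l (f : {ffun 'I_l -> 'I_k}) j m w w' :
  tcoef (insert j m f) w w' = p (w' j) (w m) * tcoef_off f m w (delete j w').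
Proof. by rewrite (tcoef_onE _ j) tcoef_on_insert insert_at. Qed.

Lemma tcoef_perm k l (f : {ffun 'I_l -> 'I_k}) (s : 'S_k) (w : {ffun 'I_k -> 'I_d}) w' :
  tcoef f [ffun j => w (s j)] w' = tcoef [ffun i => s (f i)] w w'.
Proof.
congr (_ * _); first by apply: eq_bigr => i _; rewrite !ffunE.
rewrite [RHS](reindex_inj (@perm_inj _ s)) /=; apply: eq_big => [j|j _]; last by rewrite ffunE.
congr (~~ _); apply/codomP/codomP=> -[a]; first by move->; exists a; rewrite ffunE.
by rewrite ffunE => /perm_inj->; exists a.
Qed.

Lemma dcomp_canon_injl k l r (w : {ffun 'I_k -> 'I_d}) (w' : {ffun 'I_l -> 'I_d'})
    (X : dhom K r k) :
  dcomp nu (canon_inj k l w w') X =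
  (l`!%:R)^-1 *: \sum_(f : {ffun 'I_l -> 'I_k} | injectiveb f)
     tcoef f w w' *: dcomp nu (dres K f) X.
Proof.
by rewrite dcompZl dcomp_suml; congr (_ *: _); apply: eq_bigr => f _; rewrite dcompZl.
Qed.

Lemma dcomp_canon_injr k l r (w : {ffun 'I_k -> 'I_d}) (w' : {ffun 'I_l -> 'I_d'})
    (X : dhom K l r) :
  dcomp nu X (canon_inj k l w w') =
  (l`!%:R)^-1 *: \sum_(f : {ffun 'I_l -> 'I_k} | injectiveb f)
     tcoef f w w' *: dcomp nu X (dres K f).
Proof.
by rewrite dcompZr dcomp_sumr; congr (_ *: _); apply: eq_bigr => f _; rewrite dcompZr.
Qed.

(** The inverse appears because res is indexed contravariantly. *)
Lemma dperm_dres k (s : 'S_k) : dperm K s = dres K (s^-1)%g.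
Proof.
congr dbasis; apply: eq_diag => i j; apply/eqP/eqP=> [<-|->]; first by rewrite permK.
by rewrite permKV.
Qed.

End TensorCoefficient.

Section Symmetrizer.
Variables (K : numFieldType) (nu : K).

Lemma natr_fact_neq0 n : (n`!%:R : K) != 0.
Proof. by rewrite pnatr_eq0 -lt0n fact_gt0. Qed.

(** Precomposition with the symmetrizer moves the image of an increasing map
    everywhere and orders it in all ways, so that the left hand side becomes an
    average over all injections. *)
Lemma canon_symz d d' (p : 'I_d' -> 'I_d -> K) c k l (w : {ffun 'I_k -> 'I_d})
    (w' : {ffun 'I_l -> 'I_d'}) :
  \sum_(w1 : {ffun 'I_k -> 'I_d})
     dcomp nu (\sum_(f : {ffun 'I_l -> 'I_k} | incr f) tcoef p c f w1 w' *: dres K f)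
       (symz K d k w w1) = canon_inj p c k l w w'.
Proof.
pose F (f : {ffun 'I_l -> 'I_k}) := tcoef p c f w w' *: dres K f.
transitivity ((k`!%:R)^-1 *: \sum_(f : {ffun 'I_l -> 'I_k} | incr f)
    \sum_(s : 'S_k) F [ffun i => s (f i)]); last first.
  apply: (scalerI (natr_fact_neq0 l)); rewrite /= !scalerA divff ?natr_fact_neq0 //.
  rewrite scale1r mulrC -scalerA scaler_nat sum_incr_perm -scaler_nat scalerA.
  by rewrite mulVf ?natr_fact_neq0 // scale1r.
under eq_bigr => w1 _ do rewrite /= dcompZr dcomp_suml.
rewrite -scaler_sumr exchange_big /=; congr (_ *: _); apply: eq_bigr => f /incr_injective fI.
under eq_bigr => w1 _ do rewrite dcomp_sumr big_mkcond /=.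
rewrite exchange_big [RHS](reindex_inj invg_inj) /=; apply: eq_bigr => s _.
rewrite (bigD1 [ffun j => w (s^-1%g j)]) //= big1 ?addr0.
  rewrite ifT; last by apply/forallP=> i; rewrite ffunE permK.
  rewrite dperm_dres dcompZl dcomp_dres //; last exact: perm_inj.
  rewrite /F -tcoef_perm; congr (_ *: _); apply: eq_dres => i.
  by rewrite ffunE.
move=> w1 ne; case: ifP => // /forallP e; case/eqP: ne; apply/ffunP=> j.
by rewrite ffunE -(eqP (e _)) permKV.
Qed.

Definition delta d (b a : 'I_d) : K := (b == a)%:R.

(** With p = id and c = 0 only injections without missing positions contribute,
    that is permutations, and they contribute the symmetrizer. *)
Lemma canon_inj_symz d k (w w' : {ffun 'I_k -> 'I_d}) :
  canon_inj (@delta d) (fun=> 0) k k w w' = symz K d k w w'.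
Proof.
rewrite /=; congr (_ *: _); rewrite [RHS](reindex_inj invg_inj) /= [RHS]big_mkcond /=.
symmetry; rewrite -[LHS]/(\sum_(s : 'S_k | xpredT s) _).
rewrite (_ : \sum_(s : 'S_k) _ = \sum_(s : 'S_k)
   tcoef (@delta d) (fun=> 0) [ffun i => s i] w w' *: dres K [ffun i => s i]); last first.
  apply: eq_bigr => s _; rewrite dperm_dres invgK /tcoef [X in _ * X]big1 ?mulr1; last first.
    move=> j /negP[]; apply/codomP; exists (s^-1%g j); rewrite ffunE permKV //.
  case: ifP => [/forallP e|/negbT/forallPn[j ne]].
    rewrite big1 ?scale1r => [|i _]; first by apply: eq_dres => i; rewrite ffunE.
    by rewrite /delta ffunE -(eqP (e (s i))) permK eqxx.
  rewrite (bigD1 (s^-1%g j)) //= /delta ffunE permKV (negbTE ne).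
  by rewrite mul0r scale0r.
symmetry; apply: (big_reindex (h := fun s : 'S_k => [ffun i => s i])).
- by move=> s _; apply/injectiveP=> a b; rewrite !ffunE => /perm_inj.
- by move=> s t _ _ /ffunP e; apply/permP=> i; have := e i; rewrite !ffunE.
- move=> f /injectiveP fI; exists (perm fI) => //; apply/ffunP=> i.
  by rewrite ffunE permE.
Qed.

Lemma canon_inj_id_off d k l (w : {ffun 'I_k -> 'I_d}) (w' : {ffun 'I_l -> 'I_d}) :
  k != l -> canon_inj (@delta d) (fun=> 0) k l w w' = 0.
Proof.
move=> ne; rewrite /= big1 ?scaler0 // => f /injectiveP fI.
have [j nj] : exists j, j \notin codom f.
  apply/existsP; apply: contraNT ne; rewrite negb_exists => /forallP h.
  rewrite -(card_ord l) -(card_codom fI) -{1}(card_ord k); apply/eqP/eq_card => j.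
  by have := h j; rewrite negbK => ->.
by rewrite /tcoef (bigD1 j) //= mul0r mulr0 scale0r.
Qed.

End Symmetrizer.

(** * The cocycle identity *)

Section Cocycle.
Variables (K : numFieldType) (nu : K) (d d' d'' : nat).
Variables (p : 'I_d' -> 'I_d -> K) (c : 'I_d -> K).
Variables (q : 'I_d'' -> 'I_d' -> K) (b : 'I_d' -> K).

Definition comp_lin (y : 'I_d'') (x : 'I_d) : K := \sum_z q y z * p z x.
Definition comp_form (x : 'I_d) : K := \sum_z b z * p z x.

(** The sum over the intermediate words factors over the intermediate
    positions.  A position in the image of g carries q after p, and one outside
    it carries the form b after p. *)
Lemma sum_tcoef_comp k l m (g : {ffun 'I_m -> 'I_l}) (f : {ffun 'I_l -> 'I_k}) w w'' :
  injective g -> injective f ->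
  \sum_(w1 : {ffun 'I_l -> 'I_d'}) tcoef q b g w1 w'' * tcoef p c f w w1 =
  (\prod_i comp_lin (w'' i) (w (f (g i)))) *
  \prod_(j | j \notin codom [ffun i => f (g i)])
    (if j \in codom f then comp_form (w j) else c (w j)).
Proof.
move=> gI fI.
pose r (j : 'I_l) z := if [pick i | g i == j] is Some i then q (w'' i) z else b z.
have rg i z : r (g i) z = q (w'' i) z.
  by rewrite /r; case: pickP => [i' /eqP/gI->|/(_ i)] //; rewrite eqxx.
have rgC j z : j \notin codom g -> r j z = b z.
  by rewrite /r; case: pickP => // i /eqP<-; rewrite codom_f.
have termE w1 : tcoef q b g w1 w'' * tcoef p c f w w1 =
    (\prod_j (r j (w1 j) * p (w1 j) (w (f j)))) * \prod_(j | j \notin codom f) c (w j).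
  rewrite /tcoef mulrA; congr (_ * _); rewrite big_split /=; congr (_ * _).
  rewrite [RHS](big_codomC _ gI); congr (_ * _); apply: eq_bigr => i h.
    by rewrite rg.
  by rewrite rgC.
rewrite (eq_bigr _ (fun w1 _ => termE w1)).
rewrite -mulr_suml -(bigA_distr_bigA (fun j z => r j z * p z (w (f j)))) /=.
rewrite (big_codomC _ gI) /= -mulrA; congr (_ * _).
  by apply: eq_bigr => i _; apply: eq_bigr => z _; rewrite rg.
rewrite (eq_bigr (fun j => comp_form (w (f j)))); last first.
  by move=> j nj; apply: eq_bigr => z _; rewrite rgC.
rewrite [RHS](bigID (mem (codom f))) /=; congr (_ * _); last first.
  apply: eq_big => [j|j /negbTE->] //.
  case: (boolP (j \in codom f)); rewrite ?andbF //= => nj; rewrite andbT.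
  by apply/esym/codomP=> -[i e]; rewrite ffunE in e; rewrite e codom_f in nj.
transitivity (\prod_(j | (j \in codom f) && (j \notin codom [ffun i => f (g i)])) comp_form (w j)).
  rewrite (big_codom _ _ fI); apply: eq_bigl => j; congr (~~ _).
  apply/codomP/codomP=> -[a]; first by move=> ->; exists a; rewrite ffunE.
  by rewrite ffunE => /fI->; exists a.
by apply: eq_big => [j|j /andP[->]] //; rewrite andbC.
Qed.

(** A pair of composable injections amounts to the composite h, a set S
    containing the image of h (the positions that survive the first step) and
    an ordering of S; the l! orderings cancel the normalization.  Summing over S
    expands the product over the positions outside the image of h of
    c + comp_form.  The bound n only has to exceed k, as there is no injection
    into k points from more than k points. *)
Lemma canon_inj_comp k m n (w : {ffun 'I_k -> 'I_d}) (w'' : {ffun 'I_m -> 'I_d''}) :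
  (k < n)%N ->
  \sum_(l < n) \sum_(w1 : {ffun 'I_l -> 'I_d'})
    dcomp nu (canon_inj q b l m w1 w'') (canon_inj p c k l w w1) =
  canon_inj comp_lin (fun x => c x + comp_form x) k m w w''.
Proof.
move=> lt_kn.
pose P (h : {ffun 'I_m -> 'I_k}) := \prod_i comp_lin (w'' i) (w (h i)).
pose T (h : {ffun 'I_m -> 'I_k}) (S : {set 'I_k}) : dhom K k m :=
  (P h * \prod_(j | j \notin codom h) (if j \in S then comp_form (w j) else c (w j)))
    *: dres K h.
pose Z (S : {set 'I_k}) :=
  \sum_(h : {ffun 'I_m -> 'I_k} | injectiveb h && [forall a, h a \in S]) T h S.
transitivity (\sum_(l < n) (m`!%:R)^-1 *: \sum_(S : {set 'I_k} | #|S| == l) Z S).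
  apply: eq_bigr => l _.
  transitivity ((m`!%:R)^-1 *: ((l`!%:R)^-1 *:
    \sum_(f : {ffun 'I_l -> 'I_k} | injectiveb f)
      \sum_(g : {ffun 'I_m -> 'I_l} | injectiveb g)
        T [ffun a => f (g a)] [set i in codom f])).
    under eq_bigr => w1 _ do rewrite dcomp_canon_injl.
    rewrite -scaler_sumr exchange_big /= [in RHS]exchange_big /= [in RHS]scaler_sumr; congr (_ *: _).
    apply: eq_bigr => g /injectiveP gI.
    under eq_bigr => w1 _ do rewrite dcomp_canon_injr scalerA mulrC -scalerA scaler_sumr.
    rewrite -scaler_sumr exchange_big /=; congr (_ *: _).
    apply: eq_bigr => f /injectiveP fI.
    under eq_bigr => w1 _ do rewrite scalerA dcomp_dres //.
    rewrite -scaler_suml sum_tcoef_comp // /T; congr (_ * _ *: _).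
    - by apply: eq_bigr => i _; rewrite ffunE.
    - by apply: eq_bigr => j _; rewrite inE.
    - by apply: eq_dres => i; rewrite ffunE.
  congr (_ *: _); transitivity ((l`!%:R)^-1 *:
      \sum_(f : {ffun 'I_l -> 'I_k} | injectiveb f)
      Z [set i in codom f]).
    congr (_ *: _); apply: eq_bigr => f /injectiveP fI.
    rewrite (sum_inj_factor (fun h => T h _) fI); apply: eq_bigl => h; congr (_ && _).
    by apply: eq_forallb => a; rewrite inE.
  (* The l! enumerations of each image cancel the inner normalization. *)
  rewrite sum_inj_image sumrMnl -scaler_nat scalerA mulVf ?natr_fact_neq0 //.
  by rewrite scale1r.
rewrite -scaler_sumr /=; congr (_ *: _).
transitivity (\sum_(S : {set 'I_k}) Z S).
  rewrite [RHS](partition_big (fun S : {set 'I_k} => inord #|S| : 'I_n.-1.+1) xpredT) //=.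
  case: n lt_kn => // n lt_kn; apply: eq_bigr => l _; apply: eq_bigl => S.
  rewrite -val_eqE /= inordK //; apply: leq_ltn_trans lt_kn.
  by rewrite -[k in (_ <= k)%N]card_ord max_card.
rewrite (exchange_big_dep (fun h : {ffun 'I_m -> 'I_k} => injectiveb h)) /=; last first.
  by move=> S h _ /andP[].
apply: eq_bigr => h hI; rewrite /T -scaler_suml -mulr_sumr; congr (_ * _ *: _).
(* The entries 1 and 0 on the image of h force S to contain that image. *)
transitivity (\sum_(S : {set 'I_k}) \prod_j (if j \in S
   then (if j \in codom h then 1 else comp_form (w j))
   else (if j \in codom h then 0 else c (w j)))).
  rewrite big_mkcond; apply: eq_bigr => S _; rewrite hI /=.
  case: (boolP [forall a, h a \in S]) => [/forallP hS|/forallPn[a na]].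
    rewrite /= [LHS]big_mkcond; apply: eq_bigr => j _.
    have [/codomP[a ->]|_] := boolP (j \in codom h); first by rewrite /= hS.
    by case: ifP.
  by rewrite (bigD1 (h a)) //= (negbTE na) codom_f mul0r.
rewrite -(bigA_distr 1 (GRing.add : K -> K -> K)) [RHS]big_mkcond /=.
by apply: eq_bigr => j _; case: ifP => _ /=; rewrite ?addr0 // addrC.
Qed.

End Cocycle.

(** * Composites with the operators of the Lie algebra *)

Section WordSums.
Variables (V : nmodType) (T : finType) (n : nat).

Lemma sum_words_insert (m : 'I_n.+1) (w : {ffun 'I_n -> T}) (G : {ffun 'I_n.+1 -> T} -> V) :
  \sum_(w1 : {ffun 'I_n.+1 -> T} | [forall i, w1 (lift m i) == w i]) G w1 =
  \sum_b G (insert m b w).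
Proof.
apply: big_reindex => [b _|b b' _ _ e|w1 /forallP h].
- by apply/forallP=> i; rewrite insert_lift.
- by rewrite -(insert_at m b w) e insert_at.
- exists (w1 m) => //; rewrite -[RHS](insert_delete m); congr insert.
  by apply/ffunP=> i; rewrite ffunE (eqP (h i)).
Qed.

Lemma sum_words_delete (m : 'I_n.+1) (w : {ffun 'I_n.+1 -> T}) (G : {ffun 'I_n -> T} -> V) :
  \sum_(w1 : {ffun 'I_n -> T} | [forall i, w1 i == w (lift m i)]) G w1 = G (delete m w).
Proof.
rewrite (big_pred1 (delete m w)) // => w1; apply/'forall_eqP/eqP=> [h|-> i].
  by apply/ffunP=> i; rewrite ffunE h.
by rewrite ffunE.
Qed.

Lemma sum_words_update (i : 'I_n) (w : {ffun 'I_n -> T}) (G : {ffun 'I_n -> T} -> V) :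
  \sum_(w1 : {ffun 'I_n -> T} | [forall (j | j != i), w1 j == w j]) G w1 =
  \sum_b G (update i b w).
Proof.
apply: big_reindex => [b _|b b' _ _ e|w1 /forall_inP h].
- by apply/forall_inP=> j /negbTE ne; rewrite ffunE ne.
- by have := congr1 (fun f : {ffun 'I_n -> T} => f i) e; rewrite !ffunE eqxx.
- exists (w1 i) => //; apply/ffunP=> j; rewrite ffunE; case: eqP => [->//|/eqP/h/eqP->//].
Qed.

End WordSums.

Section Operators.
Variables (K : numFieldType) (nu : K) (d : nat).

(** The part a Id_V + A of an element of the Lie algebra, with A in gl(U); the
    summand a Id_V acts by a nu. *)
Definition diag_op (a : K) (A : 'I_d -> 'I_d -> K) k : ahom K (tens d k) (tens d k) :=
  @AHom K (tens d k) (tens d k) (fun w w' =>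
    (a * nu * (w == w')%:R +
     \sum_(i < k | [forall (j | j != i), w' j == w j]) A (w' i) (w i)) *: dperm K 1).

(** The action of u in u^-, from words of length k to words of length k + 1. *)
Definition raise_op (u : 'I_d -> K) k : ahom K (tens d k) (tens d k.+1) :=
  @AHom K (tens d k) (tens d k.+1) (fun w w' =>
    (k.+1%:R)^-1 *: \sum_(l : 'I_k.+1 | [forall i, w' (lift l i) == w i])
                      u (w' l) *: dres_star K l).

(** The action of a linear form in u^+. *)
Definition lower_op (f : 'I_d -> K) k : ahom K (tens d k.+1) (tens d k) :=
  @AHom K (tens d k.+1) (tens d k) (fun w w' =>
    \sum_(l : 'I_k.+1 | [forall i, w' i == w (lift l i)])
       f (w l) *: dres K (lift l)).

Lemma dperm1_dres k : dperm K (1 : 'S_k) = dres K (@id 'I_k).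
Proof. by rewrite dperm_dres invg1; apply: eq_dres => i; rewrite perm1. Qed.

End Operators.

Section Composites.
Variables (K : numFieldType) (nu : K) (d d' : nat).
Variables (p : 'I_d' -> 'I_d -> K) (c : 'I_d -> K).
Local Notation C := (canon_inj p c).
Local Notation t := (tcoef p c).
Local Notation t_off := (tcoef_off p c).
Local Notation t_on := (tcoef_on p c).

Lemma dcomp_canon_injlZ k l r w w' (x : K) (X : dhom K r k) :
  dcomp nu (C k l w w') (x *: X) =
  (l`!%:R)^-1 *: \sum_(f : {ffun 'I_l -> 'I_k} | injectiveb f)
     (x * t f w w') *: dcomp nu (dres K f) X.
Proof.
rewrite dcompZr dcomp_canon_injl scalerA mulrC -scalerA scaler_sumr.
by congr (_ *: _); apply: eq_bigr => f _; rewrite scalerA.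
Qed.

Lemma dcomp_canon_injrZ k l r w w' (x : K) (X : dhom K l r) :
  dcomp nu (x *: X) (C k l w w') =
  (l`!%:R)^-1 *: \sum_(f : {ffun 'I_l -> 'I_k} | injectiveb f)
     (x * t f w w') *: dcomp nu X (dres K f).
Proof.
rewrite dcompZl dcomp_canon_injr scalerA mulrC -scalerA scaler_sumr.
by congr (_ *: _); apply: eq_bigr => f _; rewrite scalerA.
Qed.

(** The operator A acts in one position, which either survives (and is then seen
    through p) or is lost (and is then seen through c). *)
Lemma canon_inj_diag a A k l w w' :
  acomp nu (C k l) (diag_op nu a A k) w w' =
  (l`!%:R)^-1 *: \sum_(f : {ffun 'I_l -> 'I_k} | injectiveb f)
    (a * nu * t f w w' +
     \sum_x (\sum_b p (w' x) b * A b (w (f x))) * t_on f x w w' +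
     \sum_(i | i \notin codom f) (\sum_b c b * A b (w i)) * t_off f i w w') *: dres K f.
Proof.
rewrite /acomp [LHS]/=.
under eq_bigr => w1 _ do rewrite -/(C k l w1 w') dcomp_canon_injlZ.
rewrite -scaler_sumr exchange_big /=; congr (_ *: _); apply: eq_bigr => f /injectiveP fI.
under eq_bigr => w1 _ do rewrite dperm1_dres dcomp_dres //.
rewrite -scaler_suml; congr (_ *: _).
rewrite (eq_bigr _ (fun w1 _ => mulrDl _ _ _)).
rewrite big_split -addrA; congr (_ + _) => /=.
  rewrite (bigD1 w) //= eqxx mulr1 big1 ?addr0 // => w1 ne.
  by rewrite eq_sym (negbTE ne) mulr0 mul0r.
under eq_bigr => w1 _ do rewrite mulr_suml big_mkcond /=.
rewrite exchange_big /=.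
under eq_bigr => i _ do rewrite -big_mkcond /= (sum_words_update _ _ (fun w1 => A (w1 i) (w i) * t f w1 w')).
rewrite (big_codomC _ fI) /=; congr (_ + _).
  apply: eq_bigr => x _; rewrite mulr_suml; apply: eq_bigr => b _.
  rewrite (tcoef_onE _ _ _ x) tcoef_on_update // !ffunE eqxx.
  by rewrite mulrA [A _ _ * _]mulrC.
apply: eq_bigr => i ni; rewrite mulr_suml; apply: eq_bigr => b _.
rewrite (tcoef_offE _ _ _ _ ni) tcoef_off_update // !ffunE eqxx.
by rewrite mulrA [A _ _ * _]mulrC.
Qed.

Lemma diag_canon_inj a' A' k l w w' :
  acomp nu (diag_op nu a' A' l) (C k l) w w' =
  (l`!%:R)^-1 *: \sum_(f : {ffun 'I_l -> 'I_k} | injectiveb f)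
    (a' * nu * t f w w' +
     \sum_x (\sum_b A' (w' x) b * p b (w (f x))) * t_on f x w w') *: dres K f.
Proof.
rewrite /acomp [LHS]/=.
under eq_bigr => w1 _ do rewrite -/(C k l w w1) dcomp_canon_injrZ.
rewrite -scaler_sumr exchange_big /=; congr (_ *: _); apply: eq_bigr => f /injectiveP fI.
under eq_bigr => w1 _ do rewrite dperm1_dres dcomp_dres //.
rewrite -scaler_suml; congr (_ *: _).
rewrite (eq_bigr _ (fun w1 _ => mulrDl _ _ _)).
rewrite big_split; congr (_ + _) => /=.
  rewrite (bigD1 w') //= eqxx mulr1 big1 ?addr0 // => w1 ne.
  by rewrite (negbTE ne) mulr0 mul0r.
under eq_bigr => w1 _ do rewrite mulr_suml big_mkcond /=.
rewrite exchange_big /=; apply: eq_bigr => x _.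
rewrite -big_mkcond /=.
rewrite (eq_bigl (fun w1 : {ffun 'I_l -> 'I_d'} => [forall (j | j != x), w1 j == w' j])); last first.
  by move=> w1; apply: eq_forallb => j; rewrite [w' j == _]eq_sym.
rewrite (sum_words_update _ _ (fun w1 => A' (w' x) (w1 x) * t f w w1)).
rewrite mulr_suml; apply: eq_bigr => b _.
by rewrite (tcoef_onE _ _ _ x) tcoef_on_update_target !ffunE eqxx mulrA.
Qed.

(** The diagrams with an isolated target element: they occur only when the
    target word is nonempty, whence the case distinction. *)
Definition gap_part (v : 'I_d' -> K) k l :
    {ffun 'I_k -> 'I_d} -> {ffun 'I_l -> 'I_d'} -> dhom K k l :=
  match l with
  | 0 => fun _ _ => 0
  | l'.+1 => fun w w' => \sum_j \sum_(f : {ffun 'I_l' -> 'I_k} | injectiveb f)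
                (v (w' j) * t f w (delete j w')) *: dgap K j f
  end.

Lemma eq_gap_part v1 v2 k l w w' : v1 =1 v2 ->
  @gap_part v1 k l w w' = @gap_part v2 k l w w'.
Proof.
move=> e; case: l w' => //= l w'.
by apply: eq_bigr => j _; apply: eq_bigr => f _; rewrite e.
Qed.

(** The inserted position m is either lost, producing c(u) and a closed
    component, or it survives, producing p u in an isolated target position.  The
    sum over the k + 1 places where u can be inserted cancels the normalization
    of the operator. *)
Lemma canon_inj_raise u k l w w' :
  acomp nu (C k.+1 l) (raise_op u k) w w' =
  (l`!%:R)^-1 *: (\sum_(f : {ffun 'I_l -> 'I_k} | injectiveb f)
      ((\sum_b c b * u b) * (nu - k%:R) * t f w w') *: dres K f
    + gap_part (fun y => \sum_b p y b * u b) w w').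
Proof.
rewrite /acomp [LHS]/=.
under eq_bigr => w1 _ do rewrite -/(C k.+1 l w1 w') dcompZr dcomp_sumr big_mkcond /=.
rewrite -scaler_sumr exchange_big /=.
pose G m (f : {ffun 'I_l -> 'I_k.+1}) :=
  (\sum_b u b * t f (insert m b w) w') *: dcomp nu (dres K f) (dres_star K m).
transitivity ((l`!%:R)^-1 *: ((k.+1%:R)^-1 *: \sum_m
    \sum_(f : {ffun 'I_l -> 'I_k.+1} | injectiveb f) G m f)).
  rewrite scalerA mulrC -scalerA; congr (_ *: _); rewrite scaler_sumr.
  apply: eq_bigr => m _; rewrite -big_mkcond /=.
  rewrite (sum_words_insert _ _ (fun w1 => dcomp nu (C k.+1 l w1 w') (u (w1 m) *: dres_star K m))); cbv beta.
  rewrite (eq_bigr _ (fun b _ => dcomp_canon_injlZ _ _ _ _)).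
  rewrite -scaler_sumr exchange_big /=; congr (_ *: _); apply: eq_bigr => f _.
  rewrite /G scaler_suml; apply: eq_bigr => b _.
  by rewrite insert_at.
congr (_ *: _).
have Gsum m : \sum_(f : {ffun 'I_l -> 'I_k.+1} | injectiveb f) G m f =
   \sum_(f : {ffun 'I_l -> 'I_k} | injectiveb f)
      ((\sum_b c b * u b) * (nu - k%:R) * t f w w') *: dres K f
    + gap_part (fun y => \sum_b p y b * u b) w w'.
  rewrite (bigID (fun f : {ffun 'I_l -> 'I_k.+1} => m \notin codom f)) /=; congr (_ + _).
    rewrite sum_inj_avoid; apply: eq_bigr => f /injectiveP fI; rewrite /G.
    rewrite (@eq_dres _ _ _ _ (lift m \o f)) => [|i]; last by rewrite ffunE.
    rewrite dcomp_dres_star_skip // scalerA; congr (_ *: _).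
    rewrite -mulrA [_ * t _ _ _]mulrC mulrA; congr (_ * _).
    rewrite mulr_suml; apply: eq_bigr => b _.
    rewrite (tcoef_offE _ _ _ _ (skip_notin m f)) tcoef_off_skip delete_insert insert_at.
    by rewrite mulrA [u b * _]mulrC.
  case: l w' @G => [|l] w' G /=.
    by rewrite big1 // => f /andP[_]; rewrite negbK => /codomP[[]].
  transitivity (\sum_j \sum_(f : {ffun 'I_l.+1 -> 'I_k.+1} | injectiveb f && (f j == m)) G m f).
    rewrite (exchange_big_dep (fun f : {ffun 'I_l.+1 -> 'I_k.+1} => injectiveb f && (m \in codom f))) /=; last first.
      by move=> j f _ /andP[-> /eqP<-]; rewrite codom_f.
    apply: eq_big => [f|f]; first by rewrite negbK.
    rewrite negbK => /andP[fi /codomP[j ->]]; rewrite (big_pred1 j) //= => j'.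
    by rewrite fi (inj_eq (injectiveP _ fi)).
  apply: eq_bigr => j _; rewrite sum_inj_hit; apply: eq_bigr => f /injectiveP fI.
  rewrite /G dcomp_dres_star_hit //; congr (_ *: _).
  rewrite mulr_suml; apply: eq_bigr => b _.
  rewrite tcoef_insert tcoef_off_skip delete_insert insert_at.
  by rewrite mulrA [u b * _]mulrC.
rewrite (eq_bigr _ (fun m _ => Gsum m)) sumr_const card_ord -scaler_nat scalerA.
by rewrite mulVf ?scale1r // pnatr_eq0.
Qed.

(** The merged terms have the target position x joined to the source position
    f x: the vector u' is inserted in a slot whose source factor was consumed
    by c. *)
Lemma raise_canon_inj u' k l w w' :
  acomp nu (raise_op u' l) (C k l) w w' =
  (l.+1`!%:R)^-1 *: (gap_part u' w w' +
    \sum_(f : {ffun 'I_l.+1 -> 'I_k} | injectiveb f)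
      (\sum_x u' (w' x) * c (w (f x)) * t_on f x w w') *: dres K f).
Proof.
rewrite /acomp [LHS]/=.
under eq_bigr => w1 _ do rewrite -/(C k l w w1) dcompZl dcomp_suml big_mkcond /=.
rewrite -scaler_sumr exchange_big /= factS natrM invfM -scalerA; congr (_ *: _).
transitivity ((l`!%:R)^-1 *: \sum_j \sum_(f : {ffun 'I_l -> 'I_k} | injectiveb f)
   (u' (w' j) * t f w (delete j w')) *: (dgap K j f + \sum_(i | i \notin codom f) dres K (insert j i f))).
  rewrite scaler_sumr; apply: eq_bigr => j _; rewrite -big_mkcond /=.
  rewrite (eq_bigl (fun w1 : {ffun 'I_l -> 'I_d'} => [forall i, w1 i == w' (lift j i)])); last first.
    by move=> w1; apply: eq_forallb => i; rewrite eq_sym.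
  rewrite (sum_words_delete _ _ (fun w1 => dcomp nu (u' (w' j) *: dres_star K j) (C k l w w1))); cbv beta.
  rewrite dcomp_canon_injrZ; congr (_ *: _).
  by apply: eq_bigr => f /injectiveP fI; rewrite dcomp_star_dres.
congr (_ *: _).
transitivity (\sum_j (\sum_(f : {ffun 'I_l -> 'I_k} | injectiveb f)
      (u' (w' j) * t f w (delete j w')) *: dgap K j f +
    \sum_(f : {ffun 'I_l.+1 -> 'I_k} | injectiveb f)
      (u' (w' j) * c (w (f j)) * t_on f j w w') *: dres K f)).
  apply: eq_bigr => j _; under eq_bigr => f _ do rewrite scalerDr scaler_sumr.
  rewrite big_split; congr (_ + _); rewrite (sum_inj_insert j) /=.
  apply: eq_bigr => f _; apply: eq_bigr => i ni.
  by rewrite (tcoef_offE _ _ _ _ ni) tcoef_on_insert insert_at mulrA.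
rewrite big_split; congr (_ + _); rewrite exchange_big /=; apply: eq_bigr => f _.
by rewrite -scaler_suml.
Qed.

(** The contracted position joins the positions lost by the injection. *)
Lemma canon_inj_lower g k l w w' :
  acomp nu (C k l) (lower_op g k) w w' =
  (l`!%:R)^-1 *: \sum_(f : {ffun 'I_l -> 'I_k.+1} | injectiveb f)
    (\sum_(i | i \notin codom f) g (w i) * t_off f i w w') *: dres K f.
Proof.
rewrite /acomp [LHS]/=.
under eq_bigr => w1 _ do rewrite -/(C k l w1 w') dcomp_sumr big_mkcond /=.
rewrite exchange_big /=.
under [in RHS]eq_bigr => f _ do rewrite scaler_suml.
rewrite [in RHS](exchange_big_dep xpredT) //= scaler_sumr; apply: eq_bigr => m _.
rewrite -big_mkcond /= (sum_words_delete _ _ (fun w1 => dcomp nu (C k l w1 w') (g (w m) *: dres K (lift m)))); cbv beta.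
rewrite dcomp_canon_injlZ; congr (_ *: _).
rewrite sum_inj_avoid; apply: eq_bigr => f /injectiveP fI.
rewrite dcomp_dres //; last exact: lift_inj.
rewrite tcoef_off_skip; congr (_ *: _); apply: eq_dres => i.
by rewrite ffunE.
Qed.

(** The l + 1 target positions that can be contracted contribute equally and
    turn 1 / (l + 1)! into 1 / l!. *)
Lemma lower_canon_inj g' k l w w' :
  acomp nu (lower_op g' l) (C k l.+1) w w' =
  (l`!%:R)^-1 *: \sum_(f : {ffun 'I_l -> 'I_k} | injectiveb f)
    (\sum_(i | i \notin codom f) (\sum_b g' b * p b (w i)) * t_off f i w w') *: dres K f.
Proof.
rewrite /acomp [LHS]/=.
under eq_bigr => w1 _ do rewrite -/(C k l.+1 w w1) dcomp_suml big_mkcond /=.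
rewrite exchange_big /=.
rewrite (eq_bigr (fun _ => (l.+1`!%:R)^-1 *:
  \sum_(f : {ffun 'I_l -> 'I_k} | injectiveb f)
    (\sum_(i | i \notin codom f) (\sum_b g' b * p b (w i)) * t_off f i w w') *: dres K f)); last first.
  move=> j _; rewrite -big_mkcond /=.
  rewrite (eq_bigl (fun w1 : {ffun 'I_l.+1 -> 'I_d'} => [forall i, w1 (lift j i) == w' i])); last first.
    by move=> w1; apply: eq_forallb => i; rewrite eq_sym.
  rewrite (sum_words_insert _ _ (fun w1 => dcomp nu (g' (w1 j) *: dres K (lift j)) (C k l.+1 w w1))); cbv beta.
  rewrite (eq_bigr _ (fun b _ => dcomp_canon_injrZ _ _ _ _)).
  rewrite -scaler_sumr (eq_bigr _ (fun b _ => sum_inj_insert j _)) exchange_big /=.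
  congr (_ *: _); apply: eq_bigr => f /injectiveP fI.
  rewrite exchange_big /= scaler_suml; apply: eq_bigr => i ni.
  rewrite mulr_suml scaler_suml; apply: eq_bigr => b _.
  rewrite dcomp_dres; first 1 last.
  - exact: lift_inj.
  - exact/injective_insert.
  rewrite tcoef_insert delete_insert !insert_at mulrA; congr (_ *: _).
  by apply: eq_dres => x /=; rewrite insert_lift.
rewrite sumr_const card_ord -scaler_nat scalerA factS natrM invfM.
by rewrite mulrA divff ?mul1r // pnatr_eq0.
Qed.

End Composites.

(** * Associativity with a permutation *)

Lemma card_same_part (T : finType) (P Q : {set {set T}}) (h : T -> T) :
  partition P setT -> partition Q setT -> bijective h ->
  (forall x y, same_part Q (h x) (h y) = same_part P x y) -> #|P| = #|Q|.
Proof.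
move=> pP pQ [h' hK h'K] e.
have hI : injective h by exact: can_inj hK.
rewrite -(card_imset P (imset_inj hI)); apply: eq_card => B.
rewrite [in RHS](partition_same_part pQ) [in LHS](partition_same_part pP).
have E x : h @: [set y | same_part P x y] = [set y | same_part Q (h x) y].
  apply/setP=> y; rewrite inE; apply/imsetP/idP=> [[z + ->]|yQ]; first by rewrite inE -e.
  by exists (h' y); rewrite ?h'K // inE -e h'K.
apply/imsetP/imsetP=> [[_ /imsetP[x _ ->] ->]|[x _ ->]]; first by exists (h x); rewrite ?E.
exists [set y | same_part P (h' x) y]; last by rewrite E h'K.
exact: imset_f.
Qed.

Section PermutationAssociativity.
Variables (K : numFieldType) (nu : K).

Lemma dcompDl r s t (g1 g2 : dhom K s t) (f : dhom K r s) :
  dcomp nu (g1 + g2) f = dcomp nu g1 f + dcomp nu g2 f.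
Proof.
apply/ffunP=> T; rewrite !ffunE -big_split; apply: eq_bigr => P _.
by rewrite -big_split; apply: eq_bigr => Q _; rewrite ffunE !mulrDl.
Qed.

Lemma dcompDr r s t (g : dhom K s t) (f1 f2 : dhom K r s) :
  dcomp nu g (f1 + f2) = dcomp nu g f1 + dcomp nu g f2.
Proof.
apply/ffunP=> T; rewrite !ffunE -big_split; apply: eq_bigr => P _.
by rewrite -big_split; apply: eq_bigr => Q _; rewrite ffunE mulrDr mulrDl.
Qed.

Lemma dhom_basis r s (X : dhom K r s) :
  X = \sum_(P : pbar r s) X P *: dbasis K (diag (incidence (val P))).
Proof.
apply/ffunP=> Q; rewrite sum_ffunE (bigD1 Q) //= big1 => [|P ne].
  by rewrite !ffunE diag_incidence ?eqxx ?(valP Q) // addr0 /GRing.scale /= mulr1.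
rewrite !ffunE diag_incidence ?(valP P) // -val_eqE eq_sym in ne *.
by rewrite /GRing.scale /= (negbTE ne) mulr0.
Qed.

Lemma perm_part_inj k (s : 'S_k) : part_inj (fun i j => s i == j).
Proof. by split=> [i j j' /eqP<- /eqP|i i' j /eqP<- /eqP/perm_inj]. Qed.

Lemma dcomp_diag_perm r s (m : 'I_r -> 'I_s -> bool) (g : 'S_r) : part_inj m ->
  dcomp nu (dbasis K (diag m)) (dperm K g) = dbasis K (diag (fun i j => m (g i) j)).
Proof.
move=> hm; rewrite (@dcomp_diag_glue _ _ _ _ _ _ _ (fun i j => m (g i) j) 0%N).
- by rewrite big_ord0 scale1r.
- exact: hm.
- exact: perm_part_inj.
- split=> [i j j'|i i' j a b]; first exact: hm.1.
  exact/(@perm_inj _ g)/(hm.2 _ _ _ a b).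
- apply/eqP; rewrite cards_eq0; apply/eqP/setP=> j; rewrite !inE; apply/negbTE.
  rewrite negb_and; apply/orP; left; apply/forallPn; exists (g^-1 j)%g.
  by rewrite permKV eqxx.
- by move=> i l; apply: (iffP idP) => [a|[j [/eqP<-]]] //; exists (g i).
- by left=> i; exists (g i).
Qed.

Lemma dcomp_perm_diag r s (m : 'I_r -> 'I_s -> bool) (g : 'S_s) : part_inj m ->
  dcomp nu (dperm K g) (dbasis K (diag m)) =
  dbasis K (diag (fun i j => m i (g^-1 j)%g)).
Proof.
move=> hm; rewrite (@dcomp_diag_glue _ _ _ _ _ _ _ (fun i j => m i (g^-1 j)%g) 0%N).
- by rewrite big_ord0 scale1r.
- exact: perm_part_inj.
- exact: hm.
- split=> [i j j' a b|i i' j]; last exact: hm.2.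
  exact/(@perm_inj _ g^-1%g)/(hm.1 _ _ _ a b).
- apply/eqP; rewrite cards_eq0; apply/eqP/setP=> j; rewrite !inE; apply/negbTE.
  rewrite negb_and; apply/orP; right; apply/forallPn; exists (g j).
  by rewrite eqxx.
- move=> i l; apply: (iffP idP) => [a|[j [a /eqP<-]]]; last by rewrite permK.
  by exists (g^-1 l)%g; rewrite permKV.
- by right=> l; exists (g^-1 l)%g; rewrite permKV.
Qed.

(** Composing with g on one side of the middle row or on the other relabels the
    middle row only. *)
Lemma dcompA_mid r s t (X : dhom K s t) (g : 'S_s) (Y : dhom K r s) :
  dcomp nu (dcomp nu X (dperm K g)) Y = dcomp nu X (dcomp nu (dperm K g) Y).
Proof.
rewrite [X]dhom_basis !dcomp_suml; apply: eq_bigr => P _.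
rewrite !dcompZl; congr (_ *: _).
rewrite [Y]dhom_basis !dcomp_sumr; apply: eq_bigr => Q _.
rewrite !dcompZr; congr (_ *: _).
have := incidence_part_inj (valP P); move: (incidence _) => m2 hm2 {P X}.
have := incidence_part_inj (valP Q); move: (incidence _) => m1 hm1 {Q Y}.
rewrite dcomp_diag_perm // dcomp_perm_diag //.
have hm2' : part_inj (fun i j => m2 (g i) j).
  split=> [i j j'|i i' j a b]; first exact: hm2.1.
  exact/(@perm_inj _ g)/(hm2.2 _ _ _ a b).
have hm1' : part_inj (fun i j => m1 i (g^-1 j)%g).
  split=> [i j j' a b|i i' j]; last exact: hm1.2.
  exact/(@perm_inj _ g^-1%g)/(hm1.1 _ _ _ a b).
rewrite !dcomp_basis; try exact: part_inj_pbar.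
apply/ffunP=> S; rewrite [LHS]ffunE [RHS]ffunE /dcoef; have := valP S; move: (val S) => T hT {S}.
have -> : nmid (diag (fun i j => m2 (g i) j)) (diag m1) =
    nmid (diag m2) (diag (fun i j => m1 i (g^-1 j)%g)).
  rewrite !nmidE // -[LHS](card_imset _ (@perm_inj _ g)); apply: eq_card => j.
  apply/imsetP/idP=> [[i + ->]|]; first by rewrite !inE permK.
  by move=> h; exists (g^-1 j)%g; rewrite ?permKV // !inE permKV in h *.
have -> // : contributes (diag (fun i j => m2 (g i) j)) (diag m1) T =
    contributes (diag m2) (diag (fun i j => m1 i (g^-1 j)%g)) T.
apply/contributes_incidence/contributes_incidence => // -[h1 h2]; split.
- by move=> i j l a b; apply: h1 a _; rewrite permKV.
- move=> i l /h2 h [[j a]|[j a]].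
    have [|j' [b b']] := h; first by left; exists (g^-1 j)%g.
    by exists (g j'); rewrite permK.
  have [|j' [b b']] := h; first by right; exists (g^-1 j)%g; rewrite permKV.
  by exists (g j'); rewrite permK.
- by move=> i j l a b; apply: h1 b; rewrite permK.
- move=> i l /h2 h [[j a]|[j a]].
    have [|j' [b b']] := h; first by left; exists (g j); rewrite permK.
    by exists (g^-1 j')%g; rewrite permKV.
  have [|j' [b b']] := h; first by right; exists (g j).
  by exists (g^-1 j')%g; rewrite permKV.
Qed.

(** Composing with g on the source side relabels the source row, which changes
    neither the middle components nor the number of parts. *)
Lemma dcompA_right r s t (X : dhom K s t) (Y : dhom K r s) (g : 'S_r) :
  dcomp nu X (dcomp nu Y (dperm K g)) = dcomp nu (dcomp nu X Y) (dperm K g).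
Proof.
rewrite [X]dhom_basis !dcomp_suml; apply: eq_bigr => P _.
rewrite !dcompZl; congr (_ *: _).
rewrite [Y]dhom_basis dcomp_suml !dcomp_sumr dcomp_suml; apply: eq_bigr => Q _.
rewrite dcompZl !dcompZr dcompZl; congr (_ *: _).
have := incidence_part_inj (valP P); move: (incidence _) => m2 hm2 {P X}.
have := incidence_part_inj (valP Q); move: (incidence _) => m1 hm1 {Q Y}.
have relabel u (m : 'I_r -> 'I_u -> bool) (s0 : 'S_r) :
    part_inj m -> part_inj (fun i j => m (s0 i) j).
  move=> hm; split=> [i j j'|i i' j a b]; first exact: hm.1.
  exact/(@perm_inj _ s0)/(hm.2 _ _ _ a b).
have hm1' := relabel _ _ g hm1.
rewrite dcomp_diag_perm // [X in _ = dcomp _ X _]dhom_basis dcomp_suml.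
rewrite !dcomp_basis; try exact: part_inj_pbar.
apply/ffunP=> -[T hT]; rewrite [LHS]ffunE [RHS]sum_ffunE.
have hI := incidence_part_inj hT.
have hI' := relabel _ _ g^-1%g hI.
pose T0 : pbar r t := exist (@is_pbar r t) _ (part_inj_pbar hI').
rewrite (bigD1 T0) //= [X in _ + X]big1 ?addr0; last first.
  move=> [S hS] ne; rewrite dcompZl dcomp_diag_perm ?ffunE; last exact: incidence_part_inj.
  rewrite (_ : (_ == _) = false) ?mulr0 //=; first by rewrite /GRing.scale /= mulr0.
  apply: contraNF ne => /= /eqP e; rewrite -val_eqE /= -(diag_incidence hS).
  apply/eqP/eq_diag => i j; rewrite e incidence_diag ?permKV //.
  exact: relabel (incidence_part_inj hS).
rewrite dcompZl dcomp_diag_perm; last exact/incidence_part_inj/(valP T0).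
rewrite !ffunE /=.
rewrite (_ : (T == _) = true); last first.
  apply/eqP; rewrite -[LHS](diag_incidence hT); apply: eq_diag => i j.
  by rewrite incidence_diag // permK.
rewrite {1}/GRing.scale /= mulr1 /dcoef.
have -> : nmid (diag m2) (diag (fun i j => m1 (g i) j)) = nmid (diag m2) (diag m1).
  rewrite !nmidE //; apply: eq_card => j; rewrite !inE; congr (_ && _).
  apply/forallP/forallP=> h i; first by have := h (g^-1 i)%g; rewrite permKV.
  exact: h.
pose h (x : 'I_r + 'I_t) := match x with inl i => inl (g i) | inr j => inr j end.
have -> : #|T| = #|diag (fun i j => incidence T (g^-1 i)%g j)|.
  apply: (@card_same_part _ _ _ h); first exact: pbar_partition.
  - exact/pbar_partition/part_inj_pbar.
  - by exists (fun x => match x with inl i => inl (g^-1 i)%g | inr j => inr j end) => -[i|j] //=;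
      rewrite ?permK ?permKV.
  - move=> x y; rewrite same_part_diag // same_part_incidence //.
    case: x y => [i|j] [i'|j'] //=; rewrite /joins ?permK //=; congr (_ || _).
    by apply/eqP/eqP=> -[]; [move/perm_inj->|move->].
have -> // : contributes (diag m2) (diag (fun i j => m1 (g i) j)) T =
    contributes (diag m2) (diag m1) (diag (fun i j => incidence T (g^-1 i)%g j)).
have hT0 := part_inj_pbar hI'.
apply/contributes_incidence/contributes_incidence => // -[h1 h2]; split.
- by move=> i j l a b; rewrite incidence_diag //; apply: h1 b; rewrite permKV.
- move=> i l; rewrite incidence_diag // => /h2 h3 [[j a]|[j a]].
    have [|j' [b b']] := h3; first by left; exists j; rewrite permKV.
    by exists j'; rewrite permKV in b.
  have [|j' [b b']] := h3; first by right; exists j.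
  by exists j'; rewrite permKV in b.
- by move=> i j l a b; have := h1 _ _ _ a b; rewrite incidence_diag // permK.
- move=> i l a; apply: (h2 (g i) l); by rewrite incidence_diag // permK.
Qed.

End PermutationAssociativity.

(** * Additive envelope and direct sums *)

Section Additive.
Variables (K : numFieldType) (nu : K).

Lemma eq_acomp (X Y Z : aob) (g g' : ahom K Y Z) (f f' : ahom K X Y) :
  aeq g g' -> aeq f f' -> aeq (acomp nu g f) (acomp nu g' f').
Proof. by move=> eg ef x z; apply: eq_bigr => y _; rewrite eg ef. Qed.

Lemma acompDl (X Y Z : aob) (g1 g2 : ahom K Y Z) (f : ahom K X Y) x z :
  acomp nu (aadd g1 g2) f x z = acomp nu g1 f x z + acomp nu g2 f x z.
Proof. by rewrite -big_split; apply: eq_bigr => y _; apply: dcompDl. Qed.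

Lemma acompDr (X Y Z : aob) (g : ahom K Y Z) (f1 f2 : ahom K X Y) x z :
  acomp nu g (aadd f1 f2) x z = acomp nu g f1 x z + acomp nu g f2 x z.
Proof. by rewrite -big_split; apply: eq_bigr => y _; apply: dcompDr. Qed.

Lemma acomp0l (X Y Z : aob) (g : ahom K Y Z) (f : ahom K X Y) x z :
  aeq g (azero K Y Z) -> acomp nu g f x z = 0.
Proof. by move=> e; rewrite /acomp /= big1 // => y _; rewrite e dcomp0l. Qed.

Lemma acomp0r (X Y Z : aob) (g : ahom K Y Z) (f : ahom K X Y) x z :
  aeq f (azero K X Y) -> acomp nu g f x z = 0.
Proof. by move=> e; rewrite /acomp /= big1 // => y _; rewrite e dcomp0r. Qed.

(** The hypothesis is entrywise because it is verified below only for composites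
    with a symmetrizer in the middle or on the right. *)
Lemma acompA (A B C D : aob) (h : ahom K C D) (g : ahom K B C) (f : ahom K A B) :
  (forall i j k l, dcomp nu (h k l) (dcomp nu (g j k) (f i j)) =
                   dcomp nu (dcomp nu (h k l) (g j k)) (f i j)) ->
  aeq (acomp nu h (acomp nu g f)) (acomp nu (acomp nu h g) f).
Proof.
move=> e x z; rewrite /acomp /=; under eq_bigr => k _ do rewrite dcomp_sumr.
rewrite exchange_big; apply: eq_bigr => j _; rewrite dcomp_suml.
by apply: eq_bigr => k _; rewrite e.
Qed.

Lemma acompA_symz_right d k (B C : aob) (h : ahom K B C) (g : ahom K (tens d k) B) :
  aeq (acomp nu h (acomp nu g (symz K d k))) (acomp nu (acomp nu h g) (symz K d k)).
Proof.
apply: acompA => w w1 y z; rewrite /= !dcompZr; congr (_ *: _).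
by rewrite !dcomp_sumr; apply: eq_bigr => s _; apply: dcompA_right.
Qed.

Lemma acompA_symz_mid d k (A B : aob) (h : ahom K (tens d k) B) (f : ahom K A (tens d k)) :
  aeq (acomp nu h (acomp nu (symz K d k) f)) (acomp nu (acomp nu h (symz K d k)) f).
Proof.
apply: acompA => x w w1 z; rewrite /= dcompZl !dcompZr dcompZl; congr (_ *: _).
rewrite dcomp_suml !dcomp_sumr dcomp_suml; apply: eq_bigr => s _.
by rewrite dcompA_mid.
Qed.

Lemma place_self (A : aob) (Y : nat -> aob) m (g : ahom K A (Y m)) : place g m = g.
Proof. by rewrite /place; case: eqP => // E; rewrite (eq_axiomK E). Qed.

Lemma place_other (A : aob) (Y : nat -> aob) m l (g : ahom K A (Y m)) :
  m != l -> place g l = azero K A (Y l).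
Proof. by rewrite /place; case: eqP. Qed.

Lemma sum_acomp_placer (A Z : aob) (Y : nat -> aob) m n (g : ahom K A (Y m))
    (h : forall j, ahom K (Y j) Z) x z : (m < n)%N ->
  \sum_(j < n) acomp nu (h j) (place g j) x z = acomp nu (h m) g x z.
Proof.
move=> lt_mn; rewrite (bigD1 (Ordinal lt_mn)) // place_self big1 => [|j ne]; first exact: addr0.
by rewrite place_other ?acomp0r // eq_sym.
Qed.

(** The map s is the shift of degree of the operators: identity or successor. *)
Lemma sum_acomp_placel (A Z : nat -> aob) B (s : nat -> nat) l m n
    (g : forall j, ahom K (A j) (Z (s j))) (h : forall j, ahom K B (A j)) x z :
  (m < n)%N -> (forall j, (s j == l) = (j == m)) ->
  \sum_(j < n) acomp nu (place (g j) l) (h j) x z =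
  acomp nu (place (g m) l) (h m) x z.
Proof.
move=> lt_mn sP; rewrite (bigD1 (Ordinal lt_mn)) // big1 => [|j ne]; first exact: addr0.
by rewrite place_other ?acomp0l // sP.
Qed.

End Additive.

Section Families.
Variables (K : numFieldType) (nu : K).

Lemma blocks_comp (X Y Z : nat -> aob) (c2 : forall k l, ahom K (Y k) (Z l))
    (c1 : forall k l, ahom K (X k) (Y l)) m n q u v :
  acomp nu (blocks c2 n q) (blocks c1 m n) u v =
  \sum_(j < n) acomp nu (c2 j (tag v)) (c1 (tag u) j) (tagged u) (tagged v).
Proof.
rewrite /acomp /= -(sig_big_dep (fun _ => true) (fun _ _ => true)
  (fun (j : 'I_n) (y : aidx (Y j)) =>
     dcomp nu (c2 j (tag v) y (tagged v)) (c1 (tag u) j (tagged u) y))) /=.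
by [].
Qed.

Variables (X Y : nat -> kob nu) (c : forall k l, ahom K (X k) (Y l)).

Lemma blocks_idfam_left m n q :
  (forall k l, (k < m)%N -> (n <= l)%N -> aeq (c k l) (azero K (X k) (Y l))) ->
  (forall k l, aeq (acomp nu (kidem (Y l)) (c k l)) (c k l)) ->
  aeq (acomp nu (blocks (idfam Y) n q) (blocks c m n)) (blocks c m q).
Proof.
move=> bnd idl [k x] [l z]; rewrite blocks_comp [RHS]/=; cbn [tag tagged projT1 projT2].
have [lt_ln|le_nl] := ltnP l n.
  rewrite (bigD1 (Ordinal lt_ln)) // /idfam place_self idl.
  rewrite big1 => [|j ne]; first exact: addr0.
  by rewrite place_other ?acomp0l.
rewrite (bnd k l) // big1 // => j _; rewrite /idfam place_other ?acomp0l //; apply/eqP=> e.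
by rewrite -e leqNgt ltn_ord in le_nl.
Qed.

Lemma blocks_idfam_right m n q : (m <= n)%N ->
  (forall k l, aeq (acomp nu (c k l) (kidem (X k))) (c k l)) ->
  aeq (acomp nu (blocks c n q) (blocks (idfam X) m n)) (blocks c m q).
Proof.
move=> le_mn idr [k x] [l z]; rewrite blocks_comp [RHS]/=; cbn [tag tagged projT1 projT2].
rewrite (bigD1 (widen_ord le_mn k)) // /idfam place_self idr.
rewrite big1 => [|j ne]; first exact: addr0.
rewrite place_other ?acomp0r //; apply: contraNneq ne => e.
by apply/eqP/val_inj.
Qed.

(** It suffices that each coefficient is a morphism of the Karoubi envelope:
    compatibility with the inclusions of partial sums is then automatic. *)
Lemma dmor_is_imor (b : nat -> nat)
    (bnd : forall n k l, (k < n)%N -> (b n <= l)%N -> aeq (c k l) (azero K (X k) (Y l))) :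
  (forall k l, aeq (acomp nu (kidem (Y l)) (c k l)) (c k l)) ->
  (forall k l, aeq (acomp nu (c k l) (kidem (X k))) (c k l)) ->
  is_imor (dmor bnd).
Proof.
move=> idl idr; split=> [n|n n' le_nn'].
  by split; [apply: blocks_idfam_left => //; exact: bnd | exact: blocks_idfam_right].
exists (maxn (b n) (b n')); exists (leq_maxl _ _), (leq_maxr _ _) => u v.
rewrite [LHS](blocks_idfam_left (bnd n) idl).
transitivity (acomp nu (blocks (idfam Y) (b n') (maxn (b n) (b n')))
    (blocks c n (b n')) u v); last first.
  by apply: eq_acomp => // x y; rewrite [RHS](blocks_idfam_right le_nn' idr).
rewrite [RHS]blocks_idfam_left // => k l lt_kn le_l.
by apply: (bnd n') => //; apply: leq_trans lt_kn le_nn'.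
Qed.

End Families.

(** * Intertwining before restriction to invariants *)

Section Intertwining.
Variables (K : numFieldType) (nu : K).

Definition lower_out d g k : forall l, ahom K (tens d k) (tens d l) :=
  match k with
  | 0 => fun l => azero K _ _
  | k'.+1 => place (Y := tens d) (@lower_op K d g k')
  end.

(** The three parts of an element of the Lie algebra, collected by target
    degree. *)
Definition gl_op d a A u g k l : ahom K (tens d k) (tens d l) :=
  aadd (place (Y := tens d) (@diag_op K nu d a A k) l)
    (aadd (place (Y := tens d) (@raise_op K d u k) l) (@lower_out d g k l)).

Variables (d d' : nat) (p : 'I_d' -> 'I_d -> K) (c : 'I_d -> K).
Variables (a : K) (A : 'I_d -> 'I_d -> K) (u g : 'I_d -> K).
Variables (a' : K) (A' : 'I_d' -> 'I_d' -> K) (u' g' : 'I_d' -> K).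
Local Notation C := (canon_inj p c).
Local Notation t := (tcoef p c).
Local Notation t_off := (tcoef_off p c).
Local Notation t_on := (tcoef_on p c).
Local Notation D := (gl_op a A u g).
Local Notation D' := (gl_op a' A' u' g').

Hypothesis u'E : forall y, u' y = \sum_b p y b * u b.
Hypothesis a'E : a' = a + \sum_b c b * u b.
Hypothesis A'E : forall y x, \sum_b p y b * A b x =
  \sum_b A' y b * p b x + (\sum_b c b * u b) * p y x + u' y * c x.
Hypothesis g'E : forall x, \sum_b c b * A b x + g x =
  \sum_b g' b * p b x + (\sum_b c b * u b) * c x.

Lemma canon_inj_ltn k l w w' : (k < l)%N -> C k l w w' = 0.
Proof.
move=> lt_kl; rewrite /= big1 ?scaler0 // => f /injectiveP/leq_card.
by rewrite !card_ord leqNgt lt_kl.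
Qed.

Definition canon_lower k l : ahom K (tens d k) (tens d' l) :=
  match k with
  | 0 => azero K _ _
  | k'.+1 => acomp nu (C k' l) (lower_op g k')
  end.

Definition raise_canon k l : ahom K (tens d k) (tens d' l) :=
  match l with
  | 0 => azero K _ _
  | l'.+1 => acomp nu (raise_op u' l') (C k l')
  end.

(** Apart from the diagrams with an isolated target element, which agree, the
    comparison is made for each injection f separately.  The relations between
    the primed and unprimed data produce one summand c(u) for each of the l
    positions kept by f and for each of the k - l positions lost by f; they
    make up for the - k in nu - k. *)
Lemma intertwine_parts k l w w' :
  acomp nu (C k l) (diag_op nu a A k) w w' +
    (acomp nu (C k.+1 l) (raise_op u k) w w' + canon_lower k l w w') =
  acomp nu (diag_op nu a' A' l) (C k l) w w' +
    (raise_canon k l w w' + acomp nu (lower_op g' l) (C k l.+1) w w').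
Proof.
have -> : canon_lower k l w w' =
    (l`!%:R)^-1 *: \sum_(f : {ffun 'I_l -> 'I_k} | injectiveb f)
    (\sum_(i | i \notin codom f) g (w i) * t_off f i w w') *: dres K f.
  case: k w => [|k] w; last exact: canon_inj_lower.
  rewrite /= big1 ?scaler0 // => f _.
  by rewrite big1 ?scale0r // => -[].
have -> : raise_canon k l w w' = (l`!%:R)^-1 *: (gap_part p c u' w w' +
    \sum_(f : {ffun 'I_l -> 'I_k} | injectiveb f)
      (\sum_x u' (w' x) * c (w (f x)) * t_on f x w w') *: dres K f).
  case: l w' => [|l] w'; last exact: raise_canon_inj.
  rewrite /= big1 ?addr0 ?scaler0 // => f _.
  by rewrite big_ord0 scale0r.
rewrite canon_inj_diag canon_inj_raise diag_canon_inj lower_canon_inj.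
rewrite -(@eq_gap_part _ _ _ p c u' _ k l w w' u'E) -!scalerDr; congr (_ *: _).
rewrite !addrA [LHS](ACl (3*1*2*4)) [RHS](ACl (2*1*3*4)) /= -!addrA; congr (_ + _).
rewrite -!big_split; apply: eq_bigr => f /injectiveP fI; rewrite /= -!scalerDl; congr (_ *: _).
set cu := \sum_b c b * u b.
have T : \sum_(x < l) cu * t f w w' + \sum_(i | i \notin codom f) cu * t f w w' =
    k%:R * (cu * t f w w').
  transitivity (\sum_(i < k) cu * t f w w'); first by rewrite [RHS](big_codomC _ fI).
  by rewrite sumr_const card_ord mulr_natl.
have onE : \sum_x (\sum_b p (w' x) b * A b (w (f x))) * t_on f x w w' =
    \sum_x (\sum_b A' (w' x) b * p b (w (f x))) * t_on f x w w' +
    \sum_(x < l) cu * t f w w' + \sum_x u' (w' x) * c (w (f x)) * t_on f x w w'.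
  rewrite -!big_split; apply: eq_bigr => x _ /=.
  by rewrite A'E (tcoef_onE p c f x) !mulrDl mulrA.
have offE : \sum_(i | i \notin codom f) (\sum_b c b * A b (w i)) * t_off f i w w' +
    \sum_(i | i \notin codom f) g (w i) * t_off f i w w' =
    \sum_(i | i \notin codom f) (\sum_b g' b * p b (w i)) * t_off f i w w' +
    \sum_(i | i \notin codom f) cu * t f w w'.
  rewrite -!big_split; apply: eq_bigr => i ni /=.
  by rewrite -mulrDl g'E (tcoef_offE _ _ _ _ ni) mulrDl mulrA.
transitivity (a * nu * t f w w' + cu * (nu - k%:R) * t f w w' +
  \sum_x (\sum_b p (w' x) b * A b (w (f x))) * t_on f x w w' +
  (\sum_(i | i \notin codom f) (\sum_b c b * A b (w i)) * t_off f i w w' +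
    \sum_(i | i \notin codom f) g (w i) * t_off f i w w')).
  by ring.
rewrite onE offE a'E -/cu.
transitivity (a * nu * t f w w' + cu * (nu - k%:R) * t f w w' +
  (\sum_(x < l) cu * t f w w' + \sum_(i | i \notin codom f) cu * t f w w') +
  \sum_x (\sum_b A' (w' x) b * p b (w (f x))) * t_on f x w w' +
  \sum_x u' (w' x) * c (w (f x)) * t_on f x w w' +
  \sum_(i | i \notin codom f) (\sum_b g' b * p b (w i)) * t_off f i w w').
  by ring.
by rewrite T; ring.
Qed.

(** The number of summands differs because the operators raise the degree by at
    most one, whereas canon_inj does not raise it. *)
Lemma canon_inj_intertwines n k l w w' : (k < n)%N ->
  \sum_(j < n.+1) acomp nu (C j l) (D k j) w w' =
  \sum_(j < n) acomp nu (D' j l) (C k j) w w'.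
Proof.
move=> lt_kn.
transitivity (acomp nu (C k l) (diag_op nu a A k) w w' +
    (acomp nu (C k.+1 l) (raise_op u k) w w' + canon_lower k l w w')).
  under eq_bigr => j _ do rewrite !acompDr.
  rewrite !big_split; congr (_ + (_ + _)).
  - exact: (@sum_acomp_placer _ nu _ _ (tens d) _ _ _ (fun j => C j l) w w' (leqW lt_kn)).
  - exact: (@sum_acomp_placer _ nu _ _ (tens d) _ _ _ (fun j => C j l) w w' (lt_kn : k.+1 < n.+1)%N).
  - case: k w lt_kn => [|k] w lt_kn.
      by rewrite big1 // => j _; rewrite acomp0r.
    exact: (@sum_acomp_placer _ nu _ _ (tens d) _ _ _ (fun j => C j l) w w'
              (leqW (ltnW lt_kn))).
rewrite intertwine_parts.
(* The operators landing in degree l start from degrees up to l + 1, which may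
   exceed n; the additional summands vanish. *)
have [N [le_nN lt_l1N]] : exists N, (n <= N)%N /\ (l.+1 < N)%N.
  by exists (maxn n l.+2); rewrite leq_maxl leq_maxr.
transitivity (\sum_(j < N) acomp nu (D' j l) (C k j) w w'); last first.
  rewrite (big_ord_widen _ (fun j => acomp nu (D' j l) (C k j) w w') le_nN).
  rewrite [RHS]big_mkcond; apply: eq_bigr => j _; case: ltnP => // le_nj.
  apply: acomp0r => x y; apply: canon_inj_ltn; exact: leq_trans lt_kn le_nj.
have lt_lN := ltnW lt_l1N.
under [RHS]eq_bigr => j _ do rewrite !acompDl.
rewrite !big_split; congr (_ + (_ + _)).
- rewrite (@sum_acomp_placel _ nu (tens d') (tens d') _ id l l _
    (fun j => diag_op nu a' A' j) (fun j => C k j) w w' lt_lN) //.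
  by rewrite place_self.
- case: l w' lt_lN {lt_l1N} => [|l] w' lt_lN.
    by rewrite big1 // => j _; rewrite place_other ?acomp0l.
  rewrite (@sum_acomp_placel _ nu (tens d') (tens d') _ succn l.+1 l _
    (fun j => raise_op u' j) (fun j => C k j) w w' (ltnW lt_lN)) //.
  by rewrite place_self.
- rewrite -(big_mkord xpredT (fun j => acomp nu (lower_out g' j l) (C k j) w w')).
  rewrite -(ltn_predK lt_lN) big_nat_recl // [X in _ = X + _]acomp0l // add0r big_mkord.
  rewrite (@sum_acomp_placel _ nu (fun j => tens d' j.+1) (tens d') _ id l l _
    (fun j => lower_op g' j) (fun j => C k j.+1) w w') //.
    by rewrite place_self.
  by rewrite -ltnS (ltn_predK lt_lN).
Qed.

End Intertwining.

(** * Change of splitting *)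

Lemma eq_canon_inj (K : numFieldType) d d' (p1 p2 : 'I_d' -> 'I_d -> K) c1 c2 k l w w' :
  p1 =2 p2 -> c1 =1 c2 -> canon_inj p1 c1 k l w w' = canon_inj p2 c2 k l w w'.
Proof.
move=> ep ec; congr (_ *: _); apply: eq_bigr => f _; congr (_ * _ *: _);
  by apply: eq_bigr => i _; rewrite ?ep ?ec.
Qed.

Section Splittings.
Variables (K : numFieldType) (nu : K) (V : vectType K) (e : V).
Hypothesis e0 : e != 0.
Implicit Types (U W X : splitting e) (phi : 'End(V)) (v : V).

Fact spl_pr_linear U : linear (spl_pr U).
Proof. by move=> b u v; apply: linearP. Qed.
HB.instance Definition _ U := GRing.isLinear.Build K V V _ (spl_pr U) (spl_pr_linear U).

Fact spl_ec_linear U : scalar (spl_ec U).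
Proof. by move=> b u v; rewrite /spl_ec !linearP. Qed.
HB.instance Definition _ U := GRing.isLinear.Build K V K _ (spl_ec U) (spl_ec_linear U).

Fact ucoord_linear U i : scalar (@ucoord _ _ _ U i).
Proof. by move=> b u v; rewrite /ucoord linearP. Qed.
HB.instance Definition _ U i := GRing.isLinear.Build K V K _ (@ucoord _ _ _ U i) (ucoord_linear i).

Lemma spl_in U v : spl_pr U v \in (U : {vspace V}).
Proof. by have [] := spl_eq U v e0. Qed.

Lemma spl_sum U v : v = spl_pr U v + spl_ec U v *: e.
Proof. by have [] := spl_eq U v e0. Qed.

(** The decomposition along a direct sum is unique; all relations between the
    components in two splittings follow from this. *)
Lemma spl_uniq U v u a : u \in (U : {vspace V}) -> v = u + a *: e ->
  spl_pr U v = u /\ spl_ec U v = a.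
Proof.
move=> uU ev; have /directv_addP dU := spl_direct U.
have ed : spl_pr U v - u = (a - spl_ec U v) *: e.
  apply/eqP; rewrite scalerBl subr_eq addrAC -subr_eq opprK; apply/eqP.
  by rewrite -spl_sum addrC.
have : spl_pr U v - u \in (<[e]> :&: U)%VS.
  by rewrite memv_cap; apply/andP; split; [rewrite ed rpredZ // memv_line | rewrite rpredB // spl_in].
rewrite dU memv0 subr_eq0 => /eqP epr; split=> //.
move: ed; rewrite epr subrr => /esym/eqP; rewrite scaler_eq0 (negbTE e0) orbF.
by rewrite subr_eq0 => /eqP.
Qed.

Lemma spl_e U : spl_pr U e = 0 /\ spl_ec U e = 1.
Proof. by apply: spl_uniq; rewrite ?mem0v // add0r scale1r. Qed.

Lemma spl_space_id U u : u \in (U : {vspace V}) -> spl_pr U u = u /\ spl_ec U u = 0.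
Proof. by move=> uU; apply: spl_uniq => //; rewrite scale0r addr0. Qed.

Lemma ubase_in U (i : 'I_(\dim U)) : ubase i \in (U : {vspace V}).
Proof. by rewrite /ubase vbasis_mem // mem_nth // size_tuple. Qed.

(** Sums over the basis of U are evaluated by this: composites of matrices turn
    into composites of maps. *)
Lemma linear_expand U (f : V -> K) (u : V) : scalar f -> u \in (U : {vspace V}) ->
  f u = \sum_x f (@ubase _ _ _ U x) * ucoord x u.
Proof.
move=> lf uU; pose F := GRing.isLinear.Build K V K _ f lf.
pose fL : {scalar V} := HB.pack f F.
rewrite {1}(coord_vbasis uU) -[f]/(fL : V -> K) linear_sum; apply: eq_bigr => x _.
by rewrite linearZ mulrC.
Qed.

Lemma spl_pr_pr U W v : spl_pr W (spl_pr U v) = spl_pr W v.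
Proof. by rewrite {2}(spl_sum U v) linearD linearZ /= (spl_e W).1 scaler0 addr0. Qed.

Lemma spl_ec_pr U W v : spl_ec W v = spl_ec U v + spl_ec W (spl_pr U v).
Proof.
rewrite {1}(spl_sum U v) linearD linearZ /= (spl_e W).2 addrC.
by rewrite /GRing.scale /= mulr1.
Qed.

(** The matrix of p : U -> W. *)
Definition change_mx U W (y : 'I_(\dim W)) (x : 'I_(\dim U)) : K :=
  ucoord y (spl_pr W (ubase x)).

(** The coordinates of c : U -> K. *)
Definition change_ec U W (x : 'I_(\dim U)) : K := spl_ec W (ubase x).

Lemma change_mx_expand U W y u : u \in (U : {vspace V}) ->
  \sum_x @change_mx U W y x * ucoord x u = ucoord y (spl_pr W u).
Proof.
move=> uU; symmetry; apply: (linear_expand (f := fun v => ucoord y (spl_pr W v))) uU.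
by move=> b v v'; rewrite !linearP.
Qed.

Lemma change_ec_expand U W u : u \in (U : {vspace V}) ->
  \sum_x @change_ec U W x * ucoord x u = spl_ec W u.
Proof. by move=> uU; symmetry; apply: linear_expand uU; apply: spl_ec_linear. Qed.

Lemma change_mx_comp U W X : comp_lin (@change_mx U W) (@change_mx W X) =2 @change_mx U X.
Proof.
by move=> y x; rewrite /comp_lin change_mx_expand ?spl_in // spl_pr_pr.
Qed.

Lemma change_ec_comp U W X x :
  @change_ec U W x + comp_form (@change_mx U W) (@change_ec W X) x = @change_ec U X x.
Proof.
by rewrite /comp_form change_ec_expand ?spl_in // [RHS](spl_ec_pr W).
Qed.

Lemma change_mx_id U : @change_mx U U =2 @delta K (\dim U).
Proof.
move=> y x; rewrite /change_mx (spl_space_id (ubase_in x)).1 /ucoord /ubase.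
by rewrite coord_free ?(basis_free (vbasisP _)) // eq_sym.
Qed.

Lemma change_ec_id U : @change_ec U U =1 fun=> 0.
Proof. by move=> x; rewrite /change_ec (spl_space_id (ubase_in x)).2. Qed.

Definition canon_pair U W := canon_inj (@change_mx U W) (@change_ec U W).

Lemma canon_coefE U W k l : aeq (canon_coef nu U W k l) (canon_pair U W k l).
Proof. by move=> w w'; apply: canon_symz. Qed.

Lemma canon_pair_trans U W X k m n w w' : (k < n)%N ->
  \sum_(l < n) acomp nu (canon_pair W X l m) (canon_pair U W k l) w w' =
  canon_pair U X k m w w'.
Proof.
move=> lt_kn; rewrite [LHS](canon_inj_comp nu _ _ _ _ w w' lt_kn).
by apply: eq_canon_inj; [apply: change_mx_comp | apply: change_ec_comp].
Qed.

Lemma canon_pair_id U k l :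
  aeq (canon_pair U U k l) (idfam (sinv nu (\dim U)) k l).
Proof.
move=> w w'; rewrite [LHS](eq_canon_inj w w' (@change_mx_id U) (@change_ec_id U)).
rewrite /idfam; case: (eqVneq k l) => [|ne]; last first.
  by rewrite place_other // canon_inj_id_off.
by move=> kl; subst l; rewrite place_self canon_inj_symz.
Qed.

(** The symmetrizer is the canonical family of the pair U, U, so this is a case
    of the cocycle identity. *)
Lemma canon_pair_symz U W k l :
  aeq (acomp nu (canon_pair U W k l) (symz K _ k)) (canon_pair U W k l).
Proof.
move=> w w'; rewrite -[RHS](@canon_pair_trans U U W k l k.+1) //.
rewrite -[LHS](@sum_acomp_placer _ nu _ _ (tens (\dim U)) k k.+1 (symz K _ k)
  (fun j => canon_pair U W j l)) //.
by apply: eq_bigr => j _; apply: eq_acomp => // x y; rewrite [RHS]canon_pair_id.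
Qed.

Lemma symz_canon_pair U W k l :
  aeq (acomp nu (symz K _ l) (canon_pair U W k l)) (canon_pair U W k l).
Proof.
move=> w w'; have [lt_kl|le_lk] := ltnP k l.
  rewrite [RHS]canon_inj_ltn //; apply: acomp0r => x y; exact: canon_inj_ltn.
rewrite -[RHS](@canon_pair_trans U W W k l k.+1) //.
rewrite (bigD1 (Ordinal (le_lk : (l < k.+1)%N))) // big1 => [|j ne].
  rewrite [RHS]addr0; apply: eq_acomp => // x y.
  by rewrite [RHS]canon_pair_id /idfam place_self.
apply: acomp0l => x y; rewrite [LHS]canon_pair_id /idfam place_other //.
Qed.

(** The operators attached to phi by the splitting U, on the whole of
    U^{(x) k} (x) Delta_k; the action is their restriction to invariants. *)
Definition spl_op U phi := gl_op nu (gl_a U phi)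
  (fun b x => ucoord b (gl_A U phi (@ubase _ _ _ U x)))
  (fun b => @ucoord _ _ _ U b (gl_u U phi)) (fun x => gl_f U phi (@ubase _ _ _ U x)).

Lemma act_coefE U phi k l :
  act_coef nu U phi k l = acomp nu (spl_op U phi k l) (symz K _ k).
Proof. by case: k. Qed.

(** The hypotheses of the previous part follow from phi v = phi (p v) + c(v) phi e
    by taking components in the splitting W, where p e = 0 and c(e) = 1. *)
Lemma canon_pair_intertwines U W phi n k l w w' : (k < n)%N ->
  \sum_(j < n.+1) acomp nu (canon_pair U W j l) (spl_op U phi k j) w w' =
  \sum_(j < n) acomp nu (spl_op W phi j l) (canon_pair U W k j) w w'.
Proof.
have uE y : ucoord y (gl_u W phi) =
    \sum_b @change_mx U W y b * ucoord b (gl_u U phi).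
  by rewrite change_mx_expand ?spl_in // spl_pr_pr.
have cuE : \sum_b @change_ec U W b * ucoord b (gl_u U phi) = spl_ec W (gl_u U phi).
  by rewrite change_ec_expand // spl_in.
have aE : gl_a W phi = gl_a U phi + spl_ec W (gl_u U phi) by exact: spl_ec_pr.
have AU u : u \in (U : {vspace V}) -> gl_A U phi u \in (U : {vspace V}).
  by move=> uU; rewrite rpredB ?rpredZ ?spl_in.
have phiE v : phi v = phi (spl_pr W v) + spl_ec W v *: phi e.
  by rewrite {1}(spl_sum W v) linearD linearZ.
apply: canon_inj_intertwines.
- exact: uE.
- by rewrite cuE aE.
- move=> y x; rewrite cuE change_mx_expand ?AU ?ubase_in //.
  have -> : \sum_b ucoord y (gl_A W phi (ubase b)) * @change_mx U W b x =
      ucoord y (gl_A W phi (spl_pr W (ubase x))).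
    symmetry; apply: (linear_expand (f := fun v => ucoord y (gl_A W phi v))); last exact: spl_in.
    by move=> b v v'; rewrite /gl_A !(linearP, linearB, linearD, linearZ) /=; ring.
  rewrite /gl_A !linearB !linearZ /= spl_pr_pr {1}(phiE (ubase x)) linearD linearZ /=.
  rewrite linearD linearZ /= aE /gl_u /change_mx /change_ec.
  by rewrite /GRing.scale /=; ring.
- move=> x; rewrite cuE change_ec_expand ?AU ?ubase_in //.
  have -> : \sum_b gl_f W phi (ubase b) * @change_mx U W b x =
      gl_f W phi (spl_pr W (ubase x)).
    symmetry; apply: (linear_expand (f := gl_f W phi)); last exact: spl_in.
    by move=> b v v'; rewrite /gl_f !linearP.
  have ecE : spl_ec W (spl_pr U (phi (ubase x))) =
      spl_ec W (phi (ubase x)) - spl_ec U (phi (ubase x)).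
    by rewrite (spl_ec_pr U W (phi _)) addrAC subrr add0r.
  rewrite /gl_A /gl_f linearB linearZ /= ecE (phiE (ubase x)) !linearD !linearZ /=.
  by rewrite -/(gl_a W phi) aE /change_ec /GRing.scale /=; ring.
Qed.

End Splittings.

(** * The canonical isomorphism *)

Section CanonicalIsomorphism.
Variables (K : numFieldType) (nu : K) (V : vectType K) (e : V).
Hypothesis e0 : e != 0.
Implicit Types (U W : splitting e) (phi : 'End(V)).

Lemma canon_is_imor U W : is_imor (canon nu U W).
Proof.
have cE := @canon_coefE _ nu _ e U W.
apply: dmor_is_imor => k l x y; rewrite [RHS]cE.
  by rewrite -[RHS](symz_canon_pair nu e0); apply: eq_acomp => // a b; apply: cE.
by rewrite -[RHS](canon_pair_symz nu e0); apply: eq_acomp => // a b; apply: cE.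
Qed.

Lemma canon_comp_id U W i :
  aeq (acomp nu (blocks (canon_coef nu W U) i i) (blocks (canon_coef nu U W) i i))
      (blocks (idfam (sinv nu (\dim U))) i i).
Proof.
move=> [k x] [m z]; rewrite blocks_comp [RHS]/=; cbn [tag tagged projT1 projT2].
rewrite -[RHS](canon_pair_id nu e0).
rewrite -[RHS](@canon_pair_trans _ nu _ _ e0 U W U k m i) //.
apply: eq_bigr => l _; apply: (@eq_acomp _ nu (tens (\dim U) k) (tens (\dim W) l) (tens (\dim U) m)) => a b; apply: canon_coefE.
Qed.

Lemma canon_ind_iso U W : ind_iso (canon nu U W).
Proof.
split; first exact: canon_is_imor.
exists (canon nu W U); split; first exact: canon_is_imor.
  by move=> i; exists i, (leqnn i), (leqnn i); apply: eq_acomp => //; apply: canon_comp_id.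
by move=> i; exists i, (leqnn i), (leqnn i); apply: eq_acomp => //; apply: canon_comp_id.
Qed.

(** This is the intertwining property for the pair U, U, whose canonical family
    is the symmetrizer. *)
Lemma symz_spl_op U phi k l :
  aeq (acomp nu (symz K _ l) (spl_op nu U phi k l))
      (acomp nu (spl_op nu U phi k l) (symz K _ k)).
Proof.
move=> w w'; pose n := (maxn k l).+1.
have := @canon_pair_intertwines _ nu _ _ e0 U U phi n k l w w' (leq_maxl k l : (k < n)%N).
rewrite (eq_bigr (fun j : 'I_n.+1 => acomp nu (idfam (sinv nu (\dim U)) j l) (spl_op nu U phi k j) w w')); last first.
  by move=> j _; apply: eq_acomp => // x y; exact: canon_pair_id.
rewrite [RHS](eq_bigr (fun j : 'I_n => acomp nu (spl_op nu U phi j l) (idfam (sinv nu (\dim U)) k j) w w')); last first.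
  by move=> j _; apply: eq_acomp => // x y; exact: canon_pair_id.
rewrite (@sum_acomp_placer _ nu _ _ (tens (\dim U)) k n (symz K _ k)
  (fun j => spl_op nu U phi j l) w w') ?ltnS ?leq_maxl // => <-.
rewrite (@sum_acomp_placel _ nu (tens (\dim U)) (tens (\dim U)) _ id l l _
  (fun j => symz K _ j) (fun j => spl_op nu U phi k j) w w') ?place_self //.
by rewrite ltnS leqW // leq_maxr.
Qed.

Lemma act_symz U phi k l :
  aeq (acomp nu (act_coef nu U phi k l) (symz K _ k)) (act_coef nu U phi k l).
Proof.
move=> w w'; rewrite !act_coefE -[LHS](acompA_symz_right nu _ _).
by apply: eq_acomp => //; apply: symz_idem.
Qed.

Lemma symz_act U phi k l :
  aeq (acomp nu (symz K _ l) (act_coef nu U phi k l)) (act_coef nu U phi k l).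
Proof.
move=> w w'; rewrite -[RHS]act_symz !act_coefE [LHS]acompA_symz_right.
by apply: eq_acomp => //; apply: symz_spl_op.
Qed.

Lemma act_is_imor U phi : is_imor (act nu U phi).
Proof.
by apply: dmor_is_imor => k l; [apply: symz_act | apply: act_symz].
Qed.

(** The symmetrizer in the definition of the action is moved to the right past
    the operators and absorbed by the canonical family. *)
Lemma canon_act U W phi n k l w w' : (k < n)%N ->
  \sum_(j < n.+1) acomp nu (canon_coef nu U W j l) (act_coef nu U phi k j) w w' =
  \sum_(j < n) acomp nu (act_coef nu W phi j l) (canon_coef nu U W k j) w w'.
Proof.
move=> lt_kn.
transitivity (\sum_w1 dcomp nu
   (\sum_(j < n.+1) acomp nu (canon_pair U W j l) (spl_op nu U phi k j) w1 w')
   (symz K (\dim U) k w w1)).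
  under [RHS]eq_bigr => w1 _ do rewrite dcomp_suml.
  rewrite exchange_big; apply: eq_bigr => j _.
  rewrite act_coefE; transitivity (acomp nu (acomp nu (canon_pair U W j l)
    (spl_op nu U phi k j)) (symz K _ k) w w'); last by [].
  rewrite -[RHS]acompA_symz_right; apply: eq_acomp => // x y; exact: canon_coefE.
under eq_bigr => w1 _ do rewrite (canon_pair_intertwines nu e0 phi _ _ lt_kn) dcomp_suml.
rewrite exchange_big; apply: eq_bigr => j _.
rewrite act_coefE; transitivity (acomp nu (acomp nu (spl_op nu W phi j l)
  (canon_pair U W k j)) (symz K _ k) w w'); first by [].
rewrite -[LHS]acompA_symz_right -[RHS]acompA_symz_mid; apply: eq_acomp => // x y.
rewrite [LHS](canon_pair_symz nu e0) -[LHS](symz_canon_pair nu e0).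
by apply: eq_acomp => // a b; rewrite [RHS]canon_coefE.
Qed.

Lemma canon_intertwines U W phi :
  ieq (icomp (canon nu U W) (act nu U phi)) (icomp (act nu W phi) (canon nu U W)).
Proof.
move=> n; exists n.+1, (leqnn n.+1), (leqnn n.+1); apply: eq_acomp => //.
move=> [k x] [l z].
change (acomp nu (blocks (canon_coef nu U W) n.+1 n.+1) (blocks (act_coef nu U phi) n n.+1)
    (existT _ k x) (existT _ l z) =
  acomp nu (blocks (act_coef nu W phi) n n.+1) (blocks (canon_coef nu U W) n n)
    (existT _ k x) (existT _ l z)).
by rewrite !blocks_comp; apply: canon_act.
Qed.

End CanonicalIsomorphism.

Theorem corollary6p4p5 (R : realType) (nu : R[i]) (V : vectType R[i]) (e : V)
    (he : e != 0) (U W : splitting e) :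
  ind_iso (canon nu U W) /\
  forall phi : 'End(V),
    [/\ is_imor (act nu U phi), is_imor (act nu W phi) &
        ieq (icomp (canon nu U W) (act nu U phi))
            (icomp (act nu W phi) (canon nu U W))].
Proof.
split=> [|phi]; first exact: canon_ind_iso.
by split; [apply: act_is_imor | apply: act_is_imor | apply: canon_intertwines].
Qed.
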